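(* Let $\Omega$ be a domain in the Heisenberg group $\mathcal{H}$ foliated by a family $\Gamma$ of legendrian curves, in the following sense: there are an open interval $I\subset\mathbb{R}$, an open subset $\Lambda\subset\mathbb{R}^2$ and a $C^2$-diffeomorphism $\Phi:I\times\Lambda\to\Omega$ such that every $\Phi(\cdot,p)$, $p\in\Lambda$, is legendrian and $\Gamma=\{\Phi(\cdot,p)\ |\ p\in\Lambda\}$. Assume that there is a quadratic differential $q$ on $\Omega$ such that $B_2q=0$ and every curve in $\Gamma$ is a horizontal trajectory for $q$ with $q$-length equal to the same real constant $C>0$. Then the modulus of $\Gamma$ is $$M_4(\Gamma)=\frac{1}{C^4}\,\mathrm{Vol}_q(\Omega).$$
   Context: The Heisenberg group $\mathcal{H}$ is $\mathbb{C}\times\mathbb{R}$ (coordinates $(z,t)$) with group law $(z,t)(z',t')=(z+z',\,t+t'+2\,\mathrm{Im}(z\overline{z}'))$. Let $Z=\frac{\partial}{\partial z}+i\overline z\frac{\partial}{\partial t}$ and $\overline Z=\frac{\partial}{\partial\overline z}-iz\frac{\partial}{\partial t}$; the CR structure is spanned by $Z$, and the contact distribution is the kernel of $\omega=\mathrm{d}t-i\overline z\,\mathrm{d}z+iz\,\mathrm{d}\overline z$. A $C^1$ curve $\gamma=(\gamma_1,\gamma_2):I\to\mathcal{H}$ is legendrian if it is everywhere tangent to the contact distribution, i.e. $\dot\gamma_2(s)=-2\,\mathrm{Im}(\overline{\gamma_1(s)}\,\dot\gamma_1(s))$ for all $s$. A quadratic differential on an open set $\Omega\subset\mathcal{H}$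 is a class $[q\,\mathrm{d}z^2]_\omega$ modulo the contact form $\omega$, with $q:\Omega\to\mathbb{C}$ smooth ($C^\infty$); it is identified with the function $q$. The operator $B_2$ on $\Omega$ is $B_2[q\,\mathrm{d}z^2]_\omega=\big(\overline Z(|q|^2)+\overline q\,\overline Zq\big)\,\omega\wedge\mathrm{d}\overline z\otimes\omega$, so $B_2q=0$ means $\overline Z(|q|^2)+\overline q\,\overline Zq=0$ on $\Omega$. A legendrian curve $\gamma:I\to\Omega$ is a horizontal trajectory of $q$ if $q(\gamma(s))\,\dot\gamma_1(s)^2$ is real and $>0$ for all $s\in I$. Its $q$-length is $l_q(\gamma)=\int_I\sqrt{|q(\gamma(s))|}\,|\dot\gamma_1(s)|\,\mathrm{d}s$. The $q$-volume of $\Omega$ is $\mathrm{Vol}_q(\Omega)=\int_\Omega|q|^2\,\mathrm{d}L^3$, where $L^3$ is Lebesgue measure on $\mathbb{R}^3\cong\mathbb{C}\times\mathbb{R}$. For a family $\Gamma$ of legendrian curves in $\Omega$, $\mathrm{adm}(\Gamma)$ is the set of Borel measurable functions $\rho:\Omega\to[0,\infty]$ such that $\int_a^b\rho(\gamma(s))\,|\dot\gamma_1(s)|\,\mathrm{d}s\ge1$ for every curve $\gamma:\,]a,b[\,\to\Omega$ in $\Gamma$. The $4$-modulus of $\Gamma$ is $M_4(\Gamma)=\inf_{\rho\in\mathrm{adm}(\Gamma)}\int_\Omega\rho^4\,\mathrm{d}L^3$. Equalities between integrals and moduli are in $[0,+\infty]$. *)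

(* Defs.v *)
From HB Require Import structures.
From mathcomp Require Import all_boot all_order all_algebra.
From mathcomp Require Import all_classical all_reals all_analysis.
From mathcomp Require Import measurable_realfun.
From mathcomp.real_closed Require Import complex.

Set Implicit Arguments.
Unset Strict Implicit.
Unset Printing Implicit Defensive.
Import Order.TTheory GRing.Theory Num.Theory.
Import numFieldNormedType.Exports.

Local Open Scope classical_set_scope.
Local Open Scope ring_scope.

(** C^k maps on an open set [A] of a finite-dimensional space. All functions
    are total; the values outside [A] are irrelevant because [A] is open. *)
Fixpoint Ck_on (R : realType) (V W : normedModType R) (k : nat) (A : set V)
    (f : V -> W) : Prop :=
  match k with
  | 0 => forall x, A x -> {for x, continuous f}
  | k'.+1 => (forall x, A x -> differentiable f x) /\
             forall v : V, Ck_on k' A ('D_v f)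
  end.

Definition Ck_diffeo (R : realType) (V W : normedModType R) (k : nat)
    (A : set V) (B : set W) (f : V -> W) : Prop :=
  Ck_on k A f /\
  exists g : W -> V,
    [/\ Ck_on k B g,
        (forall x, A x -> B (f x) /\ g (f x) = x)
      & (forall y, B y -> A (g y) /\ f (g y) = y)].

(** Lebesgue measure on R^3. *)
Notation L3 :=
  ((lebesgue_measure \x lebesgue_measure) \x lebesgue_measure)%E.

Section Heisenberg.
Context {R : realType}.

(** The Heisenberg group C x R is carried by R x R x R: the point
    [((x, y), t)] has coordinates z = x + i y and t. *)
Local Notation H := (R * R * R)%type.

(** The same type, with the Borel sigma-algebra. *)
Local Notation mH :=
  (measurableTypeR R * measurableTypeR R * measurableTypeR R)%type.

Definition zc (p : H) : R[i] := Complex p.1.1 p.1.2.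
Definition tc (p : H) : R := p.2.

Definition domain (Omega : set H) : Prop :=
  [/\ open Omega, connected Omega & Omega !=set0].

Definition cderive (v : H) (f : H -> R[i]) (p : H) : R[i] :=
  Complex ('D_v (fun x => complex.Re (f x)) p)
          ('D_v (fun x => complex.Im (f x)) p).

Definition dx := cderive ((1, 0), 0).
Definition dy := cderive ((0, 1), 0).
Definition dt := cderive ((0, 0), 1).

(** The Wirtinger operator d/dzbar. *)
Definition dzbar (f : H -> R[i]) (p : H) : R[i] :=
  (dx f p + 'i%C * dy f p) / 2.

(** Zbar = d/dzbar - i z d/dt *)
Definition Zbar (f : H -> R[i]) (p : H) : R[i] :=
  dzbar f p - 'i%C * zc p * dt f p.

(** A quadratic differential [q dz^2]_omega is identified with its
    coefficient q. *)
Definition quadratic_differential (Omega : set H) (q : H -> R[i]) : Prop :=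
  forall k, Ck_on k Omega (fun p => complex.Re (q p)) /\
            Ck_on k Omega (fun p => complex.Im (q p)).

(** Coefficient of omega /\ d zbar (x) omega in B_2 [q dz^2]_omega. The norm
    of R[i] is R[i]-valued. *)
Definition B2 (q : H -> R[i]) (p : H) : R[i] :=
  Zbar (fun x => `|q x| ^+ 2) p + (q p)^*%C * Zbar q p.

(** A parametrized curve; only the values of [cmap] on [cdom] matter. *)
Record curve := Curve { cdom : set R; cmap : R -> H }.

Definition open_interval (I : set R) : Prop := open I /\ is_interval I.

Definition curve_z (c : curve) (s : R) : R[i] := zc (cmap c s).

Definition curve_dz (c : curve) (s : R) : R[i] :=
  Complex (derive1 (fun u => (cmap c u).1.1) s)
          (derive1 (fun u => (cmap c u).1.2) s).

Definition curve_dt (c : curve) (s : R) : R := derive1 (fun u => tc (cmap c u)) s.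

(** The last clause says that omega = dt - i zbar dz + i z dzbar vanishes on
    the velocity. *)
Definition legendrian (c : curve) : Prop :=
  [/\ open_interval (cdom c),
      Ck_on 1 (cdom c) (cmap c)
    & forall s, cdom c s ->
        curve_dt c s = - 2 * complex.Im ((curve_z c s)^*%C * curve_dz c s)].

Definition curve_in (Omega : set H) (c : curve) : Prop :=
  forall s, cdom c s -> Omega (cmap c s).

(** In R[i], [0 < w] means that w is real and positive. *)
Definition horizontal_trajectory (Omega : set H) (q : H -> R[i]) (c : curve)
    : Prop :=
  [/\ legendrian c, curve_in Omega c
    & forall s, cdom c s -> 0 < q (cmap c s) * curve_dz c s ^+ 2].

(** The real-valued modulus of a complex number. *)
Local Notation cmod := ComplexField.Normc.normc.

Definition q_length (q : H -> R[i]) (c : curve) : \bar R :=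
  (\int[lebesgue_measure]_(s in cdom c)
     (Num.sqrt (cmod (q (cmap c s))) * cmod (curve_dz c s))%:E)%E.

Definition q_volume (Omega : set H) (q : H -> R[i]) : \bar R :=
  (\int[L3]_(p in Omega) (cmod (q p) ^+ 2)%:E)%E.

Definition adm (Omega : set H) (Gamma : set curve) : set (H -> \bar R) :=
  [set rho : H -> \bar R |
    [/\ measurable_fun (Omega : set mH) (rho : mH -> \bar R),
        (forall p, Omega p -> (0 <= rho p)%E)
      & forall c, Gamma c ->
          (1 <= \int[lebesgue_measure]_(s in cdom c)
                  (rho (cmap c s) * (cmod (curve_dz c s))%:E))%E]].

Definition M4 (Omega : set H) (Gamma : set curve) : \bar R :=
  ereal_inf [set (\int[L3]_(p in Omega) (rho p ^+ 4))%E |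
              rho in adm Omega Gamma].

Definition foliated_by (Omega : set H) (Gamma : set curve) : Prop :=
  exists (I : set R) (Lambda : set (R * R)) (Phi : R * (R * R) -> H),
    [/\ open_interval I,
        open Lambda,
        Ck_diffeo 2 (I `*` Lambda) Omega Phi,
        (forall p, Lambda p -> legendrian (Curve I (fun s => Phi (s, p))))
      & Gamma = [set Curve I (fun s => Phi (s, p)) | p in Lambda]].

End Heisenberg.
Arguments curve : clear implicits.

(* Main.v *)
Require Import Defs.
From HB Require Import structures.
From mathcomp Require Import all_boot all_order all_algebra.
From mathcomp Require Import all_classical all_reals all_analysis.
From mathcomp Require Import measurable_realfun ring lra.
From mathcomp.real_closed Require Import complex.
Set Implicit Arguments.
Unset Strict Implicit.
Unset Printing Implicit Defensive.
Import Order.TTheory GRing.Theory Num.Theory.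
Import numFieldNormedType.Exports.
Local Open Scope classical_set_scope.
Local Open Scope ring_scope.

(** Let [w] be the horizontal vector field with [w^2 = |q|^2 (conj q)] pointing
    along the leaves. As [2 w Z w = Z (w^2)], the equation [B_2 q = 0] says that
    [w] is divergence free. On the leaves [w] is [h] times the velocity, with
    [h = |q|^(3/2) / |d gamma_1 / ds|], so that in the leaf coordinates [(s, p)]
    the measure [h dL^3] is invariant under translation in [s], and is therefore
    [ds (x) nu] for some measure [nu] on [Lambda]. For [rho] admissible, the
    integrals of [rho^4] and [|q|^2] are thus the [nu]-integrals of the integrals
    of [rho^4 / h] and [|q|^2 / h = |q|^(1/2) |d gamma_1 / ds|] over the leaves.
    The second inner integral is [C]; by Hoelder's inequality the first is at
    least [C^-3], with equality for [rho = |q|^(1/2) / C].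

    Testing the invariance against C^1 functions of the leaf coordinates makes a
    change of variables formula for [Phi] unnecessary. *)

(** * Calculus of C^1 maps *)

Section C1_calculus.
Context {R : realType}.
Implicit Types (U V W : normedModType R).

(** The weight [|q|^2 conj(q)] comes from the product rule:
    [Z (|q|^2 conj(q)) = conj(q) conj(B_2 q)]. No branch of the square root has to be chosen: on a
    horizontal leaf [q] times the square of the velocity is positive, so the velocity itself selects
    [w]. With [2 Z = X - i Y], where [X = d/dx + 2 y d/dt] and [Y = d/dy - 2 x d/dt], the real part
    of [2 Z w] is the Lebesgue divergence of [(Re w) X + (Im w) Y], because [X] and [Y] have
    divergence zero; only this real part is used. As the leaves are legendrian, this field is
    tangent to them in the [t] direction as well.

    The measure [nu] is read off from the invariance: a function [eta0] of the leaf parameter with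
    integral 1 is fixed, and [nu] integrates a function of [p] by integrating its product with
    [eta0] against [h dL^3]. Nothing bounds [Omega] or [Lambda], so [nu] is only shown to be
    sigma-finite, and measures are compared on countably many boxes whose closures lie in the
    coordinate domain. The inequality on a leaf is obtained by integrating a tangent line of [x^4],
    which involves no fractional powers and allows infinite values. *)

Definition C1at V W (f : V -> W) (x : V) : Prop :=
  (\forall y \near x, differentiable f y) /\
  forall v, {for x, continuous ('D_v f)}.

Lemma C1at_Ck_on V W (A : set V) (f : V -> W) (x : V) :
  open A -> Ck_on 1 A f -> A x -> C1at f x.
Proof.
move=> oA [df cf] Ax; split; last by move=> v; exact: cf.
by apply: filterS (open_nbhs_nbhs (conj oA Ax)) => y /df.
Qed.

Lemma C1at_differentiable V W (f : V -> W) x : C1at f x -> differentiable f x.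
Proof. by case=> /nbhs_singleton. Qed.

Lemma C1at_continuous V W (f : V -> W) x : C1at f x -> {for x, continuous f}.
Proof. by move/C1at_differentiable/differentiable_continuous. Qed.

Lemma C1at_derivable V W (f : V -> W) x v : C1at f x -> derivable f x v.
Proof. by move/C1at_differentiable/diff_derivable. Qed.

(** The first order expansion of [f] at [x] is also one of [g], so the differential of [f] serves
    for [g]. *)
Lemma near_eq_differentiable V W (f g : V -> W) x :
  (\forall y \near x, f y = g y) -> differentiable f x -> differentiable g x.
Proof.
move=> fg df; have fgx := nbhs_singleton fg.
have gE : g \o shift x = cst (g x) + 'd f x +o_ 0 id.
  have fE := diff_locally df.
  apply/eqaddoP => _/posnumP[e].
  have /eqaddoP/(_ e%:num [gt0 of e%:num]) := fE.
  have : \forall h \near (0 : V), f (h + x) = g (h + x).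
    by move: fg; rewrite (near_shift 0 x)/=; apply: filterS => h /=; rewrite subr0.
  rewrite !near_simpl; apply: filterS2 => h fgh.
  by rewrite /= !fctE/= fgh fgx.
apply/diff_locallyP; split.
  by rewrite (diff_unique (diff_continuous df) gE); exact: diff_continuous.
by rewrite (diff_unique (diff_continuous df) gE).
Qed.

Lemma C1at_near_eq V W (f g : V -> W) x :
  (\forall y \near x, f y = g y) -> C1at f x -> C1at g x.
Proof.
move=> fg [df cf]; have fg2 := near_join fg.
split.
  by apply: filterS2 fg2 df => y; exact: near_eq_differentiable.
move=> v; have D : \forall y \near x, 'D_v f y = 'D_v g y.
  by apply: filterS fg2 => y; exact: near_eq_derive.
rewrite /prop_for /continuous_at -(nbhs_singleton D).
exact: cvg_trans (near_eq_cvg D) (cf v).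
Qed.

Lemma C1at_cst V W (k : W) (x : V) : C1at (cst k) x.
Proof.
split; first by near=> y; exact: differentiable_cst.
move=> v; rewrite (_ : 'D_v _ = cst 0); first exact: cst_continuous.
by apply/funext => y; rewrite derive_cst.
Unshelve. all: by end_near. Qed.

Lemma C1at_lin V W (f : {linear V -> W}) x : continuous f -> C1at f x.
Proof.
move=> cf; have df y : differentiable f y by exact: linear_differentiable.
split; first by near=> y; exact: df.
move=> v; rewrite (_ : 'D_v _ = cst (f v)); first exact: cst_continuous.
by apply/funext => y; rewrite deriveE// diff_lin.
Unshelve. all: by end_near. Qed.

Lemma C1at_lin_comp U V W (L : {linear V -> W}) (f : U -> V) x :
  continuous L -> C1at f x -> C1at (L \o f) x.
Proof.
move=> cL [df cf]; have dL y : differentiable L y by exact: linear_differentiable.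
split; first by apply: filterS df => y dfy; exact: differentiable_comp.
have DE v : \forall y \near x, L ('D_v f y) = 'D_v (L \o f) y.
  apply: filterS df => y dfy; rewrite !deriveE//; last exact: differentiable_comp.
  rewrite (diff_comp dfy (dL _))/=.
  by rewrite (_ : 'd _ (f y) = L :> (V -> W))//; exact: diff_lin.
move=> v; rewrite /prop_for /continuous_at -(nbhs_singleton (DE v)).
apply: cvg_trans (near_eq_cvg (DE v)) _.
exact: (continuous_comp (cf v) (cL _)).
Qed.

Lemma C1at_fst U V W (f : U -> V * W) x : C1at f x -> C1at (fun y => (f y).1) x.
Proof. by apply: (@C1at_lin_comp _ _ _ fst) => y; exact: cvg_fst. Qed.

Lemma C1at_snd U V W (f : U -> V * W) x : C1at f x -> C1at (fun y => (f y).2) x.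
Proof. by apply: (@C1at_lin_comp _ _ _ snd) => y; exact: cvg_snd. Qed.

Lemma C1atD V W (f g : V -> W) x : C1at f x -> C1at g x -> C1at (f \+ g) x.
Proof.
move=> [df cf] [dg cg]; split.
  by apply: filterS2 df dg => y; exact: differentiableD.
move=> v; rewrite /prop_for /continuous_at deriveD; [|exact: C1at_derivable..].
apply: cvg_trans (cvgD (cf v) (cg v)); apply: near_eq_cvg.
by apply: filterS2 df dg => y dfy dgy; rewrite deriveD//; exact: diff_derivable.
Qed.

Lemma C1atM V (f g : V -> R) x : C1at f x -> C1at g x -> C1at (f \* g) x.
Proof.
move=> Cf Cg; have [df cf] := Cf; have [dg cg] := Cg; split.
  by apply: filterS2 df dg => y; exact: differentiableM.
move=> v; have E : \forall y \near x,
    f y * 'D_v g y + g y * 'D_v f y = 'D_v (f \* g) y.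
  apply: filterS2 df dg => y dfy dgy.
  by rewrite deriveM//; exact: diff_derivable.
rewrite /prop_for /continuous_at -(nbhs_singleton E).
apply: cvg_trans (near_eq_cvg E) _.
exact: cvgD (cvgM (C1at_continuous Cf) (cg v)) (cvgM (C1at_continuous Cg) (cf v)).
Qed.

Lemma derive_comp_scalar V (f : V -> R) (k : R -> R) x v :
  differentiable f x -> derivable k (f x) 1 ->
  differentiable (k \o f) x /\ 'D_v (k \o f) x = derive1 k (f x) * 'D_v f x.
Proof.
move=> df /derivable1_diffP dk.
have dkf : differentiable (k \o f) x by exact: differentiable_comp.
split => //; rewrite !deriveE// diff_comp//= diff1E// mulrC.
by [].
Qed.

Lemma C1at_comp_scalar V (f : V -> R) (k : R -> R) x :
  C1at f x -> (\forall t \near f x, derivable k t 1) ->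
  {for f x, continuous (derive1 k)} -> C1at (k \o f) x.
Proof.
move=> Cf dk ck; have [df cf] := Cf.
have dkf : \forall y \near x, derivable k (f y) 1.
  exact: (C1at_continuous Cf dk).
split.
  by apply: filterS2 df dkf => y dfy dky; have [] := derive_comp_scalar 0 dfy dky.
move=> v; have [_] := derive_comp_scalar v (C1at_differentiable Cf) (nbhs_singleton dk).
rewrite /prop_for /continuous_at => ->.
have ckf : {for x, continuous (derive1 k \o f)}.
  by apply: continuous_comp => //; exact: C1at_continuous.
apply: cvg_trans (cvgM ckf (cf v)); apply: near_eq_cvg.
apply: filterS2 df dkf => y dfy dky /=.
by have [_ ->] := derive_comp_scalar v dfy dky.
Qed.

Lemma derive_comp U V W (f : U -> V) (k : V -> W) x v :
  differentiable f x -> differentiable k (f x) ->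
  'D_v (k \o f) x = 'D_('D_v f x) k (f x).
Proof.
move=> df dk; have dkf : differentiable (k \o f) x by exact: differentiable_comp.
by rewrite !deriveE// (diff_comp df dk).
Qed.

Lemma derive_pair3 (k : R * (R * R) -> R) z (v : R * (R * R)) :
  differentiable k z ->
  'D_v k z = v.1 * 'D_(1, (0, 0)) k z + v.2.1 * 'D_(0, (1, 0)) k z
             + v.2.2 * 'D_(0, (0, 1)) k z.
Proof.
move=> dk; rewrite !deriveE//.
have {1}-> : v = v.1 *: (1, (0, 0)) + v.2.1 *: (0, (1, 0)) + v.2.2 *: (0, (0, 1)).
  by case: v => a [b c] /=; congr (_, (_, _)); rewrite /= /GRing.scale/=; ring.
by rewrite !linearD !linearZ.
Qed.

(** The chain rule gives the derivative of [k] at [f y] in the direction ['D_v f y], which moves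
    with [y], whereas [C1at] speaks of fixed directions. Expanding the moving direction in the
    standard basis turns the derivative into a sum of products of continuous functions. *)
Lemma C1at_comp V (f : V -> R * (R * R)) (k : R * (R * R) -> R) x :
  C1at f x -> C1at k (f x) -> C1at (k \o f) x.
Proof.
move=> Cf Ck; have [df cf] := Cf; have [dk ck] := Ck.
have dkf : \forall y \near x, differentiable k (f y).
  exact: (C1at_continuous Cf dk).
split.
  by apply: filterS2 df dkf => y dfy dky; exact: differentiable_comp.
move=> v; have E : \forall y \near x,
    ('D_v f y).1 * 'D_(1, (0, 0)) k (f y) + ('D_v f y).2.1 * 'D_(0, (1, 0)) k (f y)
             + ('D_v f y).2.2 * 'D_(0, (0, 1)) k (f y) = 'D_v (k \o f) y.
  apply: filterS2 df dkf => y dfy dky.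
  by rewrite (derive_comp v dfy dky) [RHS]derive_pair3.
rewrite /prop_for /continuous_at -(nbhs_singleton E).
apply: cvg_trans (near_eq_cvg E) _.
have cfx := C1at_continuous Cf.
have ckf w := continuous_comp cfx (ck w).
have c1 : ('D_v f y).1 @[y --> x] --> ('D_v f x).1.
  exact: (continuous_comp (cf v) cvg_fst).
have c2 : ('D_v f y).2 @[y --> x] --> ('D_v f x).2.
  exact: (continuous_comp (cf v) cvg_snd).
have c21 : ('D_v f y).2.1 @[y --> x] --> ('D_v f x).2.1.
  exact: (continuous_comp c2 cvg_fst).
have c22 : ('D_v f y).2.2 @[y --> x] --> ('D_v f x).2.2.
  exact: (continuous_comp c2 cvg_snd).
by apply: cvgD; [apply: cvgD|]; apply: cvgM => //; exact: ckf.
Qed.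

Lemma derive_fst U V W (f : U -> V * W) x v : differentiable f x ->
  'D_v (fun y => (f y).1) x = ('D_v f x).1.
Proof.
move=> df; have cL : continuous (fst : V * W -> V) by move=> y; exact: cvg_fst.
have dL : differentiable (fst : V * W -> V) (f x) by exact: linear_differentiable.
rewrite (derive_comp v df dL) deriveE//.
by rewrite (_ : 'd _ (f x) = fst :> (V * W -> V))//; exact: diff_lin.
Qed.

Lemma derive_snd U V W (f : U -> V * W) x v : differentiable f x ->
  'D_v (fun y => (f y).2) x = ('D_v f x).2.
Proof.
move=> df; have cL : continuous (snd : V * W -> W) by move=> y; exact: cvg_snd.
have dL : differentiable (snd : V * W -> W) (f x) by exact: linear_differentiable.
rewrite (derive_comp v df dL) deriveE//.
by rewrite (_ : 'd _ (f x) = snd :> (V * W -> W))//; exact: diff_lin.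
Qed.

End C1_calculus.

(** * The horizontal field of a solution of B_2 q = 0 *)

Section divergence_free.
Context {R : realType} {V : normedModType R}.
Implicit Types (a b u v : V -> R) (p : V).

Lemma derive_mul_fun u v p w : differentiable u p -> differentiable v p ->
  'D_w (fun x => u x * v x) p = u p * 'D_w v p + v p * 'D_w u p.
Proof. by move=> du dv; exact: (deriveM (diff_derivable du) (diff_derivable dv)). Qed.

Lemma derive_add_fun u v p w : differentiable u p -> differentiable v p ->
  'D_w (fun x => u x + v x) p = 'D_w u p + 'D_w v p.
Proof. by move=> du dv; exact: (deriveD (diff_derivable du) (diff_derivable dv)). Qed.

Lemma derive_sub_fun u v p w : differentiable u p -> differentiable v p ->
  'D_w (fun x => u x - v x) p = 'D_w u p - 'D_w v p.
Proof. by move=> du dv; exact: (deriveB (diff_derivable du) (diff_derivable dv)). Qed.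

Lemma derive_opp_fun u p w : differentiable u p ->
  'D_w (fun x => - u x) p = - 'D_w u p.
Proof. by move=> du; exact: (deriveN (diff_derivable du)). Qed.

Lemma differentiable_mul_fun u v p : differentiable u p -> differentiable v p ->
  differentiable (fun x => u x * v x) p.
Proof. by move=> du dv; exact: (differentiableM du dv). Qed.

Lemma differentiable_add_fun u v p : differentiable u p -> differentiable v p ->
  differentiable (fun x => u x + v x) p.
Proof. by move=> du dv; exact: (differentiableD du dv). Qed.

Lemma differentiable_sum_sqr u v p : differentiable u p -> differentiable v p ->
  differentiable (fun x => u x ^+ 2 + v x ^+ 2) p.
Proof.
by move=> du dv; apply: (differentiable_add_fun (u := fun x => u x ^+ 2)
  (v := fun x => v x ^+ 2)); exact: differentiable_mul_fun.
Qed.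

Lemma derive_sum_sqr u v p w : differentiable u p -> differentiable v p ->
  'D_w (fun x => u x ^+ 2 + v x ^+ 2) p = 2 * u p * 'D_w u p + 2 * v p * 'D_w v p.
Proof.
move=> du dv; have := derive_add_fun w (differentiable_mul_fun du du)
  (differentiable_mul_fun dv dv).
rewrite !(@derive_mul_fun _ _ p w)// => H.
transitivity (u p * 'D_w u p + u p * 'D_w u p + (v p * 'D_w v p + v p * 'D_w v p)).
  exact: H.
by ring.
Qed.

(* With [w = a + i b], the hypotheses say [w^2 = N (u - i v)], and the claim is
   the real part of [2 w Z w = Z (w^2)]. *)
Lemma divergence_free a b u v p (x1 x2 : V) :
  let N x := u x ^+ 2 + v x ^+ 2 in
  differentiable a p -> differentiable b p ->
  differentiable u p -> differentiable v p ->
  (\forall x \near p, a x ^+ 2 - b x ^+ 2 = N x * u x) ->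
  (\forall x \near p, 2 * a x * b x = - (N x * v x)) ->
  0 < a p ^+ 2 + b p ^+ 2 ->
  3 * 'D_x1 N p + 2 * v p * 'D_x2 u p - 2 * u p * 'D_x2 v p = 0 ->
  3 * 'D_x2 N p + 2 * u p * 'D_x1 v p - 2 * v p * 'D_x1 u p = 0 ->
  'D_x1 a p + 'D_x2 b p = 0.
Proof.
move=> N da db du dv eA eB ab0 h1 h2.
have dN : differentiable N p by exact: differentiable_sum_sqr.
have DN w := derive_sum_sqr w du dv.
have daa := differentiable_mul_fun da da.
have dbb := differentiable_mul_fun db db.
have dab := differentiable_mul_fun da db.
have DA w : 2 * a p * 'D_w a p - 2 * b p * 'D_w b p
            = u p * 'D_w N p + N p * 'D_w u p.
  rewrite [RHS]addrC -(derive_mul_fun w dN du).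
  have <- : 'D_w (fun x => a x * a x - b x * b x) p = 'D_w (fun x => N x * u x) p.
    exact: near_eq_derive.
  by rewrite (derive_sub_fun w daa dbb) !derive_mul_fun//; ring.
have DB w : 2 * (a p * 'D_w b p + b p * 'D_w a p)
            = - (v p * 'D_w N p + N p * 'D_w v p).
  rewrite [X in - X]addrC -(derive_mul_fun w dN dv).
  rewrite -(derive_opp_fun w (differentiable_mul_fun dN dv)).
  have <- : 'D_w (fun x => a x * b x + a x * b x) p = 'D_w (fun x => - (N x * v x)) p.
    by apply: near_eq_derive; apply: filterS eB => x /= <-; ring.
  by rewrite (derive_add_fun w dab dab) !derive_mul_fun//; ring.
have eAp := nbhs_singleton eA; have eBp := nbhs_singleton eB.
apply: (mulfI (lt0r_neq0 ab0)); rewrite mulr0.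
move: (DA x1) (DA x2) (DB x1) (DB x2) h1 h2 eAp eBp; rewrite /N !DN.
move: (a p) (b p) (u p) (v p) ('D_x1 a p) ('D_x2 a p) ('D_x1 b p) ('D_x2 b p)
  ('D_x1 u p) ('D_x2 u p) ('D_x1 v p) ('D_x2 v p).
move=> A B U V0 a1 a2 b1 b2 u1 u2 v1 v2 A1 A2 B1 B2 h1 h2 _ _.
apply: (mulfI (_ : 2 != 0 :> R)); first by rewrite pnatr_eq0.
(* With [w = A + i B] and [2 Z] for ['D_x1 - i 'D_x2], this is the real part of
   [2 |w|^2 (2 Z w) = conj(w) 2 Z (w^2)]. *)
transitivity (A * ((2 * A * a1 - 2 * B * b1) + 2 * (A * b2 + B * a2)) +
    B * (2 * (A * b1 + B * a1) - (2 * A * a2 - 2 * B * b2))); first by ring.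
rewrite A1 A2 B1 B2 mulr0.
(* Once [w^2 = N (U - i V0)] is differentiated, what remains is half the real part of the conjugate
   of [w q E], where [q = U + i V0] and [E] has the left sides of [h1] and [h2] as real and
   imaginary parts. The two coefficients are the halves of the parts of [w q]. *)
transitivity ((A * U - B * V0) / 2 *
    (3 * (2 * U * u1 + 2 * V0 * v1) + 2 * V0 * u2 - 2 * U * v2) -
  (A * V0 + B * U) / 2 *
    (3 * (2 * U * u2 + 2 * V0 * v2) + 2 * U * v1 - 2 * V0 * u1)); first by field.
by rewrite h1 h2 !mulr0 subr0.
Qed.

End divergence_free.

Section Zbar_real.
Context {R : realType}.
Local Notation H := (R * R * R)%type.

(** The left-invariant horizontal fields [hX] and [hY], for which [Z = (hX - i hY) / 2]. *)
Definition hX (p : H) : H := ((1, 0), 2 * p.1.2).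
Definition hY (p : H) : H := ((0, 1), - 2 * p.1.1).

Lemma derive_triple (k : H -> R) z (v : H) :
  differentiable k z ->
  'D_v k z = v.1.1 * 'D_((1, 0), 0) k z + v.1.2 * 'D_((0, 1), 0) k z
             + v.2 * 'D_((0, 0), 1) k z.
Proof.
move=> dk; rewrite !deriveE//.
have {1}-> : v = v.1.1 *: ((1, 0), 0) + v.1.2 *: ((0, 1), 0) + v.2 *: ((0, 0), 1).
  by case: v => [[a b] c] /=; congr ((_, _), _); rewrite /= /GRing.scale/=; ring.
by rewrite !linearD !linearZ.
Qed.

Lemma Re_sqr_normC (z : R[i]) :
  complex.Re (`|z| ^+ 2) = complex.Re z ^+ 2 + complex.Im z ^+ 2.
Proof.
case: z => a b; rewrite /Num.norm/= expr2/=.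
by rewrite mulr0 subr0 -expr2 sqr_sqrtr// addr_ge0// sqr_ge0.
Qed.

Lemma Im_sqr_normC (z : R[i]) : complex.Im (`|z| ^+ 2) = 0.
Proof. by case: z => a b; rewrite /Num.norm/= expr2/=; ring. Qed.

(** The two identities are four times the real and the imaginary part of [B2 q p = 0], by
    [Zbar = (hX + i hY) / 2]. The coefficient 3 is 2 from [Zbar (|q|^2)] plus 1 from the derivatives
    [u du + v dv = dN / 2] hidden in [conj(q) Zbar q]. *)
Lemma B2_eq0 (q : H -> R[i]) (p : H) :
  let u x := complex.Re (q x) in let v x := complex.Im (q x) in
  let N x := u x ^+ 2 + v x ^+ 2 in
  differentiable u p -> differentiable v p -> B2 q p = 0 ->
  3 * 'D_(hX p) N p + 2 * v p * 'D_(hY p) u p - 2 * u p * 'D_(hY p) v p = 0 /\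
  3 * 'D_(hY p) N p + 2 * u p * 'D_(hX p) v p - 2 * v p * 'D_(hX p) u p = 0.
Proof.
move=> u v N du dv.
have dN : differentiable N p by exact: differentiable_sum_sqr.
have DN w : 'D_w N p = 2 * u p * 'D_w u p + 2 * v p * 'D_w v p.
  exact: derive_sum_sqr.
have NE : (fun x => complex.Re (`|q x| ^+ 2)) = N.
  by apply/funext => x; exact: Re_sqr_normC.
have N0 : (fun x => complex.Im (`|q x| ^+ 2)) = cst 0.
  by apply/funext => x; exact: Im_sqr_normC.
rewrite /B2 /Zbar /dzbar /dx /dy /dt /cderive NE N0 !derive_cst.
rewrite -/u -/v.
rewrite !(@derive_triple N p (hX p))// (@derive_triple N p (hY p))//.
rewrite !(@derive_triple u p (hX p))// (@derive_triple u p (hY p))//.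
rewrite !(@derive_triple v p (hX p))// (@derive_triple v p (hY p))//.
rewrite !DN /hX /hY /=.
rewrite /zc.
have -> : q p = Complex (u p) (v p) by rewrite /u /v; case: (q p).
move/eqP; rewrite eq_complex /= => /andP[/eqP + /eqP].
move: (u p) (v p) ('D_(1, 0, 0) u p) ('D_(0, 1, 0) u p) ('D_(0, 0, 1) u p)
  ('D_(1, 0, 0) v p) ('D_(0, 1, 0) v p) ('D_(0, 0, 1) v p) p.1.1 p.1.2.
move=> a b ux uy ut vx vy vt x y.
(* The left side is what the real part of the inverse of the complex number 2 in [dzbar] computes
   to. *)
have -> : (1 + 1) / ((1 + 1) ^+ 2 + (0 + 0) ^+ 2) = 2^-1 :> R by field.
rewrite !(addr0, mul0r, oppr0, mul1r, mulr0, subr0, add0r).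
by move=> h1 h2; split; lra.
Qed.

End Zbar_real.

(** * Measures on products of lines *)

Section borel_product.
Context {R : realType}.
Local Notation mR := (measurableTypeR R).
Local Notation H := (R * R * R)%type.
Local Notation X := (R * (R * R))%type.
Local Notation mH := (mR * mR * mR)%type.
Local Notation mX := (mR * (mR * mR))%type.

Lemma measurable_fun_pair_on d d1 d2 (T : measurableType d)
    (T1 : measurableType d1) (T2 : measurableType d2) (D : set T)
    (f : T -> T1) (g : T -> T2) : measurable D ->
  measurable_fun D f -> measurable_fun D g ->
  measurable_fun D (fun x => (f x, g x)).
Proof.
move=> mD /(measurable_restrictT _ mD) mf /(measurable_restrictT _ mD) mg.
have /(measurable_funS measurableT (@subsetT _ D)) := measurable_fun_pair mf mg.
by apply: eq_measurable_fun => x xD; rewrite !patchE xD.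
Qed.

Lemma nbhs_rat_itv (x : R) (A : set R) : nbhs x A ->
  exists q : rat * rat, (ratr q.1 < x < ratr q.2) /\ `[ratr q.1, ratr q.2] `<=` A.
Proof.
move=> /nbhs_ballP[e /= e0 eA].
have /rat_in_itvoo[a /itvP ha] : x - e < x by rewrite gtrBl.
have /rat_in_itvoo[b /itvP hb] : x < x + e by rewrite ltrDl.
exists (a, b); split => /=; first by rewrite ha hb.
apply: subset_trans eA => y /=; rewrite in_itv/= => /andP[ay yb].
by rewrite ball_itv/= in_itv/= (lt_le_trans _ ay) ?ha// (le_lt_trans yb)// hb.
Qed.

(** Boxes with rational corners, enumerated by [unpickle]. The closed boxes lie in [O], which
    provides compactness and room for test functions, while the open ones already cover [O]. *)
Lemma open_box_cover (O : set X) : open O ->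
  exists j k c d e f : nat -> R,
    (forall n, `[j n, k n] `*` (`[c n, d n] `*` `[e n, f n]) `<=` O) /\
    O `<=` \bigcup_n (`]j n, k n[ `*` (`]c n, d n[ `*` `]e n, f n[)).
Proof.
move=> oO.
pose T := ((rat * rat) * ((rat * rat) * (rat * rat)))%type.
pose P (t : T) := `[ratr t.1.1, ratr t.1.2] `*` (`[ratr t.2.1.1, ratr t.2.1.2]
   `*` `[ratr t.2.2.1, ratr t.2.2.2]) `<=` O.
(* A code that does not denote a box inside [O] is sent to the box with lower corners 1 and upper
   corners 0, which is empty. *)
pose F n : T := if unpickle n is Some t then
  if `[< P t >] then t else ((1, 0), ((1, 0), (1, 0))) else ((1, 0), ((1, 0), (1, 0))).
exists (fun n => ratr (F n).1.1), (fun n => ratr (F n).1.2),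
  (fun n => ratr (F n).2.1.1), (fun n => ratr (F n).2.1.2),
  (fun n => ratr (F n).2.2.1), (fun n => ratr (F n).2.2.2).
have F0 : P ((1, 0), ((1, 0), (1, 0))).
  move=> [x y] [/= + _]; rewrite rmorph0 rmorph1 in_itv/= => /andP[x1 x0].
  by have := le_trans x1 x0; rewrite ler10.
split=> [n|[x [y z]] Oxyz].
  by rewrite /F; case: unpickle => // t; case: asboolP.
have [[A B] /= [xA yzB] ABO] : nbhs (x, (y, z)) O by exact: open_nbhs_nbhs.
have [[C D] /= [yC zD] CDB] := yzB.
have [q1 [q1x q1A]] := nbhs_rat_itv xA.
have [q2 [q2y q2C]] := nbhs_rat_itv yC.
have [q3 [q3z q3D]] := nbhs_rat_itv zD.
have [n Fn] : exists n, unpickle n = Some ((q1, (q2, q3)) : T).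
  by exists (pickle ((q1, (q2, q3)) : T)); rewrite pickleK.
exists n => //; rewrite /F Fn; case: asboolP => [_|[]].
  by split => /=; [|split]; rewrite in_itv.
move=> [x' [y' z']] [/= x'q [y'q z'q]]; apply: ABO; split => /=; first exact: q1A.
by apply: CDB; split; [exact: q2C|exact: q3D].
Qed.

(** The sigma-algebra of [mX] is the product one; it contains the open sets because each of them is
    a countable union of boxes. *)
Lemma open_measurable3 (O : set X) : open O -> measurable (O : set mX).
Proof.
move=> oO; have [j [k [c [d [e [f [sO Os]]]]]]] := open_box_cover oO.
rewrite (_ : O = \bigcup_n (`]j n, k n[ `*` (`]c n, d n[ `*` `]e n, f n[))).
  by apply: bigcupT_measurable => n; do 2 (apply: measurableX; [exact: measurable_itv|]);
    exact: measurable_itv.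
apply/seteqP; split => // z [n _ [zj [zc ze]]]; apply: (sO n).
by split; [|split]; exact: subset_itv_oo_cc.
Qed.

Lemma open_measurable2 (O : set (R * R)) : open O ->
  measurable (O : set (mR * mR)%type).
Proof.
move=> oO; pose h (p : R * R) : X := (0, p).
have mO : measurable ((snd @^-1` O) : set mX).
  by apply: open_measurable3; apply: open_comp => // z _; exact: cvg_snd.
have mh : measurable_fun [set: (mR * mR)%type] (h : _ -> mX).
  by apply: measurable_fun_pair => //; exact: measurable_id.
have := mh measurableT _ mO; rewrite setTI.
by congr (measurable _).
Qed.

Lemma open_measurableH (O : set H) : open O -> measurable (O : set mH).
Proof.
move=> oO; pose k (p : X) : H := ((p.1, p.2.1), p.2.2).
pose h (p : H) : X := (p.1.1, (p.1.2, p.2)).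
have ck : continuous k.
  move=> z; have c1 : x.1 @[x --> z] --> z.1 by exact: cvg_fst.
  have c2 : x.2 @[x --> z] --> z.2 by exact: cvg_snd.
  have c21 : x.2.1 @[x --> z] --> z.2.1 by exact: (continuous_comp c2 cvg_fst).
  have c22 : x.2.2 @[x --> z] --> z.2.2 by exact: (continuous_comp c2 cvg_snd).
  exact: (cvg_pair (cvg_pair c1 c21) c22).
have mO : measurable ((k @^-1` O) : set mX).
  by apply: open_measurable3; apply: open_comp => // z _; exact: ck.
have mh : measurable_fun [set: mH] (h : _ -> mX).
  apply: measurable_fun_pair; first exact: (measurableT_comp measurable_fst measurable_fst).
  apply: measurable_fun_pair; last exact: measurable_snd.
  exact: (measurableT_comp measurable_snd measurable_fst).
have := mh measurableT _ mO; rewrite setTI.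
congr (measurable _); apply/seteqP.
by split=> -[[x y] z].
Qed.

(** The map [i] stands for the identity from the measurable copy of a space to the topological one,
    so that a single proof serves both groupings of the three factors. *)
Lemma continuous_measurable_fun_gen (T : topologicalType) d (mT : measurableType d)
    (D : set T) (f : T -> R) (i : mT -> T) :
  (forall O : set T, open O -> measurable (i @^-1` O)) ->
  open D -> (forall x, D x -> {for x, continuous f}) ->
  measurable_fun (i @^-1` D) (f \o i).
Proof.
move=> oM oD cf; apply: (measurability _ (RGenOpens.measurableE R)).
move=> _ [_ [a [b ->] <-]].
rewrite (_ : _ `&` _ = i @^-1` (D `&` f @^-1` `]a, b[))//; apply: oM.
rewrite openE => x [Dx fx]; rewrite /interior.
apply: filterI; first exact: open_nbhs_nbhs.
by apply: (cf x Dx); apply: open_nbhs_nbhs; split => //; exact: interval_open.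
Qed.

Lemma continuous_measurable3 (D : set X) (f : X -> R) : open D ->
  (forall x, D x -> {for x, continuous f}) ->
  measurable_fun (D : set mX) (f : mX -> R).
Proof. exact: (@continuous_measurable_fun_gen _ _ mX D f id open_measurable3). Qed.

Lemma continuous_measurableH (D : set H) (f : H -> R) : open D ->
  (forall x, D x -> {for x, continuous f}) ->
  measurable_fun (D : set mH) (f : mH -> R).
Proof. exact: (@continuous_measurable_fun_gen _ _ mH D f id open_measurableH). Qed.

End borel_product.

(** * Push-forward of a measure with a density *)

Section image_density.
Context d1 d2 (Y : measurableType d1) (X : measurableType d2) (R : realType).
Variables (mu : {measure set Y -> \bar R}).
Variables (phi : Y -> X) (mphi : measurable_fun [set: Y] phi).
Variables (w : Y -> R) (mw : measurable_fun [set: Y] w).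
Variable (w0 : forall y, 0 <= w y).

(* The proofs are arguments so that the measure structure can be inferred. *)
Definition image_density
    of measurable_fun [set: Y] phi & measurable_fun [set: Y] w
     & (forall y, 0 <= w y) :=
  fun A : set X => (\int[mu]_(y in phi @^-1` A) (w y)%:E)%E.

Local Notation nu := (image_density mphi mw w0).

Let mwE D : measurable_fun D (EFin \o w).
Proof. by apply: measurable_funS (_ : measurable_fun setT _) => //; exact/measurable_EFinP. Qed.

Let mpre A : measurable A -> measurable (phi @^-1` A).
Proof. by move=> mA; rewrite -[_ @^-1` _]setTI; exact: mphi. Qed.

Let nu0 : nu set0 = 0%E.
Proof. by rewrite /image_density preimage_set0 integral_set0. Qed.

Let nu_ge0 A : (0 <= nu A)%E.
Proof. by apply: integral_ge0 => y _; rewrite lee_fin. Qed.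

Let nu_sigma_additive : semi_sigma_additive nu.
Proof.
move=> F mF tF mUF; rewrite /image_density preimage_bigcup ge0_integral_bigcup//.
- by apply: is_cvg_ereal_nneg_natsum_cond => n _ _; exact: nu_ge0.
- by move=> k; exact: mpre.
- by move=> y _; rewrite lee_fin.
- move=> i j _ _ [y [Fi Fj]]; apply: tF => //.
  by exists (phi y).
Qed.

HB.instance Definition _ := isMeasure.Build _ _ _ nu nu0 nu_ge0 nu_sigma_additive.

Import HBNNSimple.

(** For the indicator of a set this is the definition of the measure; linearity extends it to simple
    functions and monotone convergence to [f]. *)
Lemma integral_image_density (f : X -> \bar R) :
  measurable_fun [set: X] f -> (forall x, (0 <= f x)%E) ->
  (\int[nu]_x f x = \int[mu]_y (f (phi y) * (w y)%:E))%E.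
Proof.
move=> mf f0.
pose f_ := nnsfun_approx measurableT mf.
have f_cvg x : (f_ n x)%:E @[n --> \oo] --> f x.
  by apply: cvg_nnsfun_approx => // z _; exact: f0.
transitivity (limn (fun n => \int[nu]_x (f_ n x)%:E))%E.
  rewrite -monotone_convergence//.
  - by apply: eq_integral => y _; apply/esym/cvg_lim => //; exact: f_cvg.
  - by move=> n; exact/measurable_EFinP/measurable_funP.
  - by move=> n y _; rewrite lee_fin.
  - by move=> y _ m n mn; rewrite lee_fin; exact/lefP/nd_nnsfun_approx.
have mfphi n : measurable_fun [set: Y] (fun y => (f_ n (phi y))%:E).
  by apply/measurable_EFinP; apply: measurableT_comp.
transitivity (limn (fun n => \int[mu]_y ((f_ n (phi y))%:E * (w y)%:E)))%E; last first.
  rewrite -monotone_convergence//.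
  - apply: eq_integral => y _; apply/cvg_lim => //.
    by apply: cvgeZr => //; exact: f_cvg.
  - by move=> n; exact: emeasurable_funM.
  - by move=> n y _; rewrite mule_ge0// lee_fin.
  - move=> y _ m n mn; rewrite lee_wpmul2r ?lee_fin//.
    exact/lefP/nd_nnsfun_approx.
congr (limn _); apply/funext => n; rewrite integralT_nnsfun sintegralE.
transitivity (\sum_(k \in range (f_ n))
    \int[mu]_y ((k * \1_(f_ n @^-1` [set k]) (phi y))%:E * (w y)%:E))%E.
  apply: eq_fsbigr => k _.
  have mk : measurable (f_ n @^-1` [set k]) by exact: measurable_funPTI.
  have m1 : measurable_fun [set: Y] (fun y => (\1_(f_ n @^-1` [set k]) (phi y) : R)%:E).
    by apply/measurable_EFinP; apply: measurableT_comp.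
  have [k0|k0] := leP 0 k; last first.
    rewrite preimage_nnfun0// measure0 mule0 integral0_eq// => y _.
    by rewrite indic0 mulr0 mul0e.
  under eq_integral do rewrite EFinM -muleA.
  rewrite ge0_integralZl//; last 2 first.
  - exact: emeasurable_funM.
  - by move=> y _; rewrite mule_ge0// lee_fin.
  congr (_ * _)%E; rewrite [LHS]integral_mkcond; apply: eq_integral => y _.
  rewrite patchE indicE; have [|] := boolP (y \in _); rewrite ?inE/= => yk.
    by rewrite mem_set// mul1e.
  by rewrite memNset ?mul0e// => ?; move/negP: yk; apply; rewrite inE.
rewrite -ge0_integral_fsum//; last 2 first.
- move=> k; apply: emeasurable_funM => //; apply/measurable_EFinP.
  by apply: measurable_funM => //; apply: measurableT_comp => //; exact: measurable_indic.
- by move=> k y _; rewrite mule_ge0 ?lee_fin// -lee_fin nnfun_muleindic_ge0.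
apply: eq_integral => y _.
rewrite -ge0_mule_fsuml; last by move=> k; rewrite nnfun_muleindic_ge0.
by rewrite fsumEFin// -fimfunE.
Qed.

End image_density.

(** * Uniqueness of measures that agree on open boxes *)

Section generated_by_rectangles.

(** As both families contain [setT], a cylinder over a generator is itself a rectangle of the
    family; hence the two projections are measurable for the sigma-algebra generated by these
    rectangles. *)
Lemma prod_measurable_generated d1 d2 (T1 : measurableType d1)
    (T2 : measurableType d2) (G1 : set (set T1)) (G2 : set (set T2)) :
  G1 setT -> G2 setT -> measurable = <<s G1 >> -> measurable = <<s G2 >> ->
  (@measurable _ (T1 * T2)%type) = <<s [set A `*` B | A in G1 & B in G2] >>.
Proof.
move=> G1T G2T mG1 mG2; rewrite measurable_prod_measurableType.
set G := [set A `*` B | A in G1 & B in G2].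
apply/seteqP; split; last first.
  apply: smallest_sub; first exact: smallest_sigma_algebra.
  move=> _ [A GA] [B GB] <-; apply: sub_sigma_algebra.
  exists A; first by rewrite mG1; exact: sub_sigma_algebra.
  by exists B => //; rewrite mG2; exact: sub_sigma_algebra.
have mfst : measurable_fun setT (fst : g_sigma_algebraType G -> T1).
  apply: (measurability _ mG1) => _ [A GA <-]; apply: sub_sigma_algebra.
  by exists A => //; exists setT => //; rewrite setTI setXT.
have msnd : measurable_fun setT (snd : g_sigma_algebraType G -> T2).
  apply: (measurability _ mG2) => _ [A GA <-]; apply: sub_sigma_algebra.
  by exists setT => //; exists A => //; rewrite setTI setTX.
apply: smallest_sub; first exact: smallest_sigma_algebra.
move=> _ [A mA] [B mB] <-.
have := measurableI _ _ (mfst measurableT _ mA) (msnd measurableT _ mB).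
by rewrite !setTI.
Qed.

End generated_by_rectangles.

Section box_unique.
Context {R : realType}.
Local Notation mR := (measurableTypeR R).
Local Notation mX := (mR * (mR * mR))%type.

(* Adding [setT] to the open intervals makes the pi-system of boxes stable
   under products. *)
Let G1 : set (set mR) := [set A | A = setT \/ exists a b, A = `]a, b[%classic].
Let G2 := [set A `*` B | A in G1 & B in G1].
Let G3 := [set A `*` B | A in G1 & B in G2].

Let mG1 : measurable = <<s G1 >>.
Proof.
apply/seteqP; split.
  have -> : @measurable _ mR = <<s @RGenOpens.G R >> by exact: RGenOpens.measurableE.
  by apply: sub_sigma_algebra2 => A [a [b ->]]; right; exists a, b.
apply: smallest_sub; first exact: sigma_algebra_measurable.
by move=> _ [->|[a [b ->]]]; [exact: measurableT|exact: measurable_itv].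
Qed.

Let mG3 : (@measurable _ mX) = <<s G3 >>.
Proof.
have G1T : G1 setT by left.
apply: prod_measurable_generated => //.
  by exists setT => //; exists setT => //; rewrite setXTT.
exact: prod_measurable_generated.
Qed.

Lemma setI_itvoo (a b c d : R) :
  `]a, b[ `&` `]c, d[ = `](Num.max a c), (Num.min b d)[%classic.
Proof.
apply/seteqP; split=> x /=; rewrite !in_itv/= gt_max lt_min.
  by move=> [/andP[-> ->] /andP[-> ->]].
by move=> /andP[/andP[-> ->] /andP[-> ->]].
Qed.

Let G1I A B : G1 A -> G1 B -> G1 (A `&` B).
Proof.
move=> [->|[a [b ->]]] [->|[c [d ->]]]; rewrite ?setTI ?setIT.
- by left.
- by right; exists c, d.
- by right; exists a, b.
- by right; rewrite setI_itvoo; eexists; eexists.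
Qed.

Let G1_itvoo A a b : G1 A ->
  exists c d, [/\ a <= c, d <= b & A `&` `]a, b[ = `]c, d[%classic].
Proof.
move=> [->|[c [d ->]]]; first by rewrite setTI; exists a, b.
exists (Num.max c a), (Num.min d b); split; last exact: setI_itvoo.
  by rewrite le_max lexx orbT.
by rewrite ge_min lexx orbT.
Qed.

Local Notation box a b c d e f := (`]a, b[ `*` (`]c, d[ `*` `]e, f[)).

(** The pi-system [G3] is applied to the restrictions of [m1] and [m2] to the box. A member of [G3]
    meets the box in a smaller, possibly empty, open box, so agreement on sub-boxes is all that is
    required. *)
Lemma measure_unique_box (m1 m2 : {measure set mX -> \bar R}) (j k c d e f : R) :
  (m1 (box j k c d e f) < +oo)%E ->
  (forall j' k' c' d' e' f', j <= j' -> k' <= k -> c <= c' -> d' <= d ->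
    e <= e' -> f' <= f ->
    m1 (box j' k' c' d' e' f') = m2 (box j' k' c' d' e' f')) ->
  forall A, measurable A -> m1 (A `&` box j k c d e f) = m2 (A `&` box j k c d e f).
Proof.
move=> fin m12 A mA.
have mB : measurable (box j k c d e f : set mX).
  by do 2 (apply: measurableX; [exact: measurable_itv|]); exact: measurable_itv.
have mTE : G3 setT.
  exists setT; first by left.
  exists setT; last by rewrite setXTT.
  by exists setT; [left|exists setT; [left|rewrite setXTT]].
(* The restricted measures are finite, so the constant sequence [setT] can serve as the exhausting
   sequence. *)
apply: (measure_unique G3 (fun=> setT) mG3 _ _ _ (mrestr m1 mB) (mrestr m2 mB)) => //.
- move=> _ _ [A1 GA1 [_ [A2 GA2 [A3 GA3 <-]] <-]] [B1 GB1 [_ [B2 GB2 [B3 GB3 <-]] <-]].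
  exists (A1 `&` B1); first exact: G1I.
  exists ((A2 `&` B2) `*` (A3 `&` B3)); last by rewrite !setXI.
  by exists (A2 `&` B2); [exact: G1I|exists (A3 `&` B3); [exact: G1I|]].
- by rewrite bigcup_const.
- move=> _ [A1 GA1 [_ [A2 GA2 [A3 GA3 <-]] <-]].
  have [j' [k' [j1 k1 E1]]] := G1_itvoo j k GA1.
  have [c' [d' [c1 d1 E2]]] := G1_itvoo c d GA2.
  have [e' [f' [e1 f1 E3]]] := G1_itvoo e f GA3.
  have E : (A1 `*` (A2 `*` A3)) `&` box j k c d e f = box j' k' c' d' e' f'.
    by rewrite -E1 -E2 -E3; apply/seteqP; split=> -[x [y z]] /=; tauto.
  by have := m12 _ _ _ _ _ _ j1 k1 c1 d1 e1 f1; rewrite -E.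
- move=> _; apply: le_lt_trans fin; rewrite -[leLHS]/(m1 (setT `&` _)).
  by rewrite setTI.
Qed.

(** The sets [seqDU F n] are disjoint and have the same union as the [F n]; each piece of [A] lies
    in one [F n], and sigma-additivity adds the pieces. *)
Lemma measure_unique_cover d' (T : measurableType d') (m1 m2 : {measure set T -> \bar R})
    (F : (set T)^nat) :
  (forall n, measurable (F n)) ->
  (forall n A, measurable A -> m1 (A `&` F n) = m2 (A `&` F n)) ->
  forall A, measurable A -> A `<=` \bigcup_n F n -> m1 A = m2 A.
Proof.
move=> mF m12 A mA AF.
have -> : A = \bigcup_n (A `&` seqDU F n).
  by rewrite -setI_bigcupr -seqDU_bigcup_eq; apply/esym/setIidl.
have mS n : measurable (A `&` seqDU F n).
  by apply: measurableI => //; apply: measurableD => //; exact: bigsetU_measurable.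
have tS : trivIset setT (fun n => A `&` seqDU F n).
  by apply: trivIset_setIl; exact: trivIset_seqDU.
rewrite !measure_semi_bigcup//; try exact: bigcupT_measurable.
apply: eq_eseriesr => n _.
have -> : A `&` seqDU F n = (A `&` seqDU F n) `&` F n.
  by apply/esym/setIidl => x [_ []].
exact: m12.
Qed.

End box_unique.

Definition prod_measure d1 d2 (T1 : measurableType d1) (T2 : measurableType d2)
    (R : realType) (m1 : {measure set T1 -> \bar R})
    (m2 : {sigma_finite_measure set T2 -> \bar R})
  : {measure set (T1 * T2)%type -> \bar R} := (m1 \x m2)%E.

Lemma prod_measureE d1 d2 (T1 : measurableType d1) (T2 : measurableType d2)
    (R : realType) (m1 : {measure set T1 -> \bar R})
    (m2 : {sigma_finite_measure set T2 -> \bar R}) A B :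
  measurable A -> measurable B -> prod_measure m1 m2 (A `*` B) = (m1 A * m2 B)%E.
Proof. exact: product_measure1E. Qed.

(* [L3] as a measure structure: unification does not find one on the iterated
   product by itself. *)
Definition lebesgue3 (R : realType)
  : {measure set (measurableTypeR R * measurableTypeR R * measurableTypeR R)%type
      -> \bar R} :=
  prod_measure (prod_measure (@lebesgue_measure R) (@lebesgue_measure R))
    (@lebesgue_measure R).

(** * Compactly supported divergences *)

Section divergence_theorem.
Context {R : realType}.
Local Notation mR := (measurableTypeR R).
Local Notation H := (R * R * R)%type.
Local Notation mH := (mR * mR * mR)%type.
Local Notation mu := (@lebesgue_measure R).

Lemma bounded_support_integrable d (T : measurableType d)
    (m : {measure set T -> \bar R}) (K : set T) (f : T -> R) (M : R) :
  measurable K -> (m K < +oo)%E -> measurable_fun setT f ->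
  (forall x, `|f x| <= M) -> (forall x, ~ K x -> f x = 0) ->
  m.-integrable setT (EFin \o f).
Proof.
move=> mK fK mf fM f0.
have -> : EFin \o f = (EFin \o f) \_ K.
  apply/funext => x; rewrite patchE; case: ifPn => //.
  by rewrite notin_setE => /f0 /= ->.
apply/integrable_restrict => //; rewrite setTI.
apply: measurable_bounded_integrable => //.
  exact: measurable_funS mf.
exists M; split; first exact: num_real.
by move=> x Mx y _; apply: le_trans (fM y) _; exact: ltW.
Qed.

(** Along the affine line [c] of velocity [e], the difference quotients of [F \o c] are those of [F]
    in the direction [e]. This reduces partial derivatives to calculus in one variable. *)
Lemma derive_line (V W : normedModType R) (F : V -> W) (c : R -> V) (e : V) (x : R) :
  (forall h, c (h + x) = h *: e + c x) ->
  derivable F (c x) e ->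
  derivable (F \o c) x 1 /\ derive1 (F \o c) x = 'D_e F (c x).
Proof.
move=> cE dF.
have E : (fun h => h^-1 *: ((F \o c \o shift x) (h *: 1) - (F \o c) x)) =
         (fun h => h^-1 *: ((F \o shift (c x)) (h *: e) - F (c x))).
  by apply/funext => h /=; rewrite [h *: 1]mulr1 cE.
split; first by rewrite /derivable E.
by rewrite derive1E /derive E.
Qed.

Lemma integral_derive1_eq0 (f : R -> R) (n : R) : 0 < n ->
  (forall x, derivable f x 1) -> continuous (derive1 f) ->
  (forall x, ~ `[- n, n]%classic x -> f x = 0) ->
  (\int[mu]_x (derive1 f x)%:E = 0)%E.
Proof.
move=> n0 df cf f0.
have cont_f : continuous f.
  by move=> x; apply: differentiable_continuous; exact/derivable1_diffP.
have out x : (x < - n) || (n < x) -> f x = 0.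
  by move=> nx; apply: f0 => /=; rewrite in_itv/= => /andP[a b]; move: nx;
    rewrite !ltNge a b.
have f'0 x : ~ `[- n, n]%classic x -> derive1 f x = 0.
  move=> nx; rewrite derive1E -(derive_cst (0 : R) x 1); apply: near_eq_derive.
  have [xn|xn] : (x < - n) \/ (n < x).
    by move: nx => /= /negP; rewrite in_itv/= negb_and -!ltNge => /orP.
    by near=> y; rewrite out//; apply/orP; left; near: y; exact: lt_nbhsl.
  by near=> y; rewrite out//; apply/orP; right; near: y; exact: lt_nbhsr.
(* The interval is enlarged by 1 on either side so that its end points lie strictly outside the
   support and [f] vanishes there. *)
pose a := - n - 1; pose b := n + 1.
have ab : a < b by rewrite /a /b; lra.
have sub : `[- n, n] `<=` `[a, b].
  by move=> x /=; rewrite !in_itv/= => /andP[h1 h2]; apply/andP; rewrite /a /b; split; lra.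
transitivity (\int[mu]_(x in `[a, b]) (derive1 f x)%:E)%E.
  rewrite [RHS]integral_mkcond; apply: eq_integral => x _.
  rewrite patchE; case: ifPn => //; rewrite notin_setE => xab.
  by rewrite f'0// => /sub.
rewrite (@continuous_FTC2 _ (derive1 f) f a b ab).
- have -> : f b = 0 by apply: out; apply/orP; right; rewrite /b; lra.
  have -> : f a = 0 by apply: out; apply/orP; left; rewrite /a; lra.
  by rewrite sube0.
- by apply: continuous_subspaceT => x; exact: cf.
- split; first by move=> x _.
    by apply: cvg_at_right_filter; exact: cont_f.
  by apply: cvg_at_left_filter; exact: cont_f.
- by [].
Unshelve. all: by end_near. Qed.

Let square (n : R) : set (R * R) := `[- n, n] `*` `[- n, n].

Let cube (n : R) : set H := square n `*` `[- n, n].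

Let measurable_square (n : R) : measurable (square n : set (mR * mR)%type).
Proof. by apply: measurableX; exact: measurable_itv. Qed.

Let itv_fin (a b : R) : (mu `[a, b]%classic < +oo)%E.
Proof. by rewrite lebesgue_measure_itv/=; case: ifP => _; rewrite // -EFinB ltry. Qed.

Let square_fin (n : R) : ((mu \x mu) (square n : set (mR * mR)%type) < +oo)%E.
Proof.
rewrite product_measure1E; [|exact: measurable_itv..].
by rewrite lte_mul_pinfty ?ge0_fin_numE// ?itv_fin.
Qed.

Let sigma_finite_mu2 : sigma_finite setT (mu \x mu)%E.
Proof.
exists (fun n : nat => square n%:R); last by move=> n; split; [exact: measurable_square|].
rewrite predeqE => -[x y]; split => // _.
exists (Num.truncn (Num.max `|x| `|y|)).+1 => //.
have := truncnS_gt (Num.max `|x| `|y|).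
rewrite gt_max => /andP[/ltW xn /ltW yn].
by split => /=; rewrite in_itv/= -ler_norml.
Qed.

(** A name for the planar measure, to which the sigma-finite structure used by Fubini's theorem is
    attached. *)
Let mu2 : set (mR * mR)%type -> \bar R := (mu \x mu)%E.

HB.instance Definition _ := Measure.on mu2.
HB.instance Definition _ := Measure_isSigmaFinite.Build _ _ _ mu2 sigma_finite_mu2.

Lemma lebesgue3_cube_fin (n : R) : (lebesgue3 R (cube n) < +oo)%E.
Proof.
rewrite prod_measureE; [|exact: measurable_square|exact: measurable_itv].
by rewrite lte_mul_pinfty ?ge0_fin_numE// ?itv_fin ?square_fin.
Qed.

Lemma continuous_compact_support_bounded (G : H -> R) (n : R) : continuous G ->
  (forall p, ~ cube n p -> G p = 0) -> exists M, forall p, `|G p| <= M.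
Proof.
move=> cG G0.
have cK : compact (cube n).
  by do 2 (apply: compact_setX; last exact: segment_compact); exact: segment_compact.
have [M [_ hM]] : bounded_set (G @` cube n).
  apply: compact_bounded; apply: continuous_compact => //.
  exact: continuous_subspaceT.
exists (Num.max 0 (M + 1)) => p; have [Kp|Kp] := pselect (cube n p).
  rewrite le_max; apply/orP; right; apply: hM; first by rewrite ltrDl.
  by exists p.
by rewrite G0// normr0 le_max lexx.
Qed.

Lemma continuous_compact_support_integrable (G : H -> R) (n : R) :
  continuous G -> (forall p, ~ cube n p -> G p = 0) ->
  (lebesgue3 R).-integrable setT (EFin \o G).
Proof.
move=> cG G0; have [M hM] := continuous_compact_support_bounded cG G0.
apply: (@bounded_support_integrable _ mH (lebesgue3 R) (cube n) G M) => //.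
- by apply: measurableX; [exact: measurable_square|exact: measurable_itv].

- exact: lebesgue3_cube_fin.
- exact: (continuous_measurableH openT (fun x _ => cG x)).
Qed.

(** By Fubini's theorem with the coordinate of [e] integrated first: on each line parallel to [e],
    the derivative of a compactly supported function has integral zero. *)
Lemma integral_derive_eq0 (F : H -> R) (n : R) (e : H) : 0 < n ->
  e \in [:: ((1, 0), 0); ((0, 1), 0); ((0, 0), 1)] ->
  (forall p, C1at F p) -> (forall p, ~ cube n p -> F p = 0) ->
  (lebesgue3 R).-integrable setT (EFin \o 'D_e F) /\
  (\int[lebesgue3 R]_p ('D_e F p)%:E = 0)%E.
Proof.
move=> n0 he CF F0.
have cK : closed (cube n).
  apply: compact_closed; first exact: norm_hausdorff.
  by do 2 (apply: compact_setX; last exact: segment_compact); exact: segment_compact.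
have cDF : continuous ('D_e F) by move=> p; have [_] := CF p; exact.
have DF0 p : ~ cube n p -> 'D_e F p = 0.
  move=> Kp; rewrite -(derive_cst (0 : R) p e); apply: near_eq_derive.
  have : nbhs p (~` cube n) by apply: open_nbhs_nbhs; split => //; exact: closed_openC.
  by apply: filterS => z; exact: F0.
have iDF := continuous_compact_support_integrable cDF DF0.
split => //.
have [M hM] := continuous_compact_support_bounded cDF DF0.
have mDF : measurable_fun setT ('D_e F : mH -> R).
  exact: (continuous_measurableH openT (fun x _ => cDF x)).
have line (c : R -> H) : continuous c ->
    (forall h x, c (h + x) = h *: e + c x) ->
    (forall x, ~ `[- n, n]%classic x -> ~ cube n (c x)) ->
    (\int[mu]_x ('D_e F (c x))%:E = 0)%E.
  move=> cc cE cn.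
  have dFc x := derive_line (cE ^~ x) (@C1at_derivable _ _ _ F (c x) e (CF (c x))).
  rewrite -(@integral_derive1_eq0 (F \o c) n n0).
  - by apply: eq_integral => x _; have [_ ->] := dFc x.
  - by move=> x; have [] := dFc x.
  - rewrite (_ : derive1 (F \o c) = 'D_e F \o c).
      by move=> x; apply: continuous_comp; [exact: cc|exact: cDF].
    by apply/funext => x; have [_ ->] := dFc x.
  - by move=> x nx; apply: F0; exact: cn.
have mslice (t : R) : measurable_fun setT (fun p : mR * mR => 'D_e F (p, t)).
  have mp : measurable_fun setT (fun p : (mR * mR)%type => (p, t : mR)).
    exact: measurable_fun_pair.
  exact: (measurableT_comp mDF mp).
have islice (t : R) : (mu \x mu)%E.-integrable setT
    (EFin \o (fun p : mR * mR => 'D_e F (p, t))).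
  apply: (@bounded_support_integrable _ (mR * mR)%type (mu \x mu)%E (square n)
    (fun p => 'D_e F (p, t)) M) => //.
    exact: square_fin.
  by move=> p Kp; apply: DF0 => -[].
have E21 := @integral21_prod_meas1 _ _ (mR * mR)%type mR R mu2 mu
  (EFin \o 'D_e F) iDF.
have E12 := @integral12_prod_meas1 _ _ (mR * mR)%type mR R mu2 mu
  (EFin \o 'D_e F) iDF.
move: he; rewrite !inE => /or3P[/eqP eE|/eqP eE|/eqP eE].
- apply: etrans (esym E21) _; apply: integral0_eq => t _.
  apply: etrans (esym (integral21_prod_meas1 (islice t))) _; apply: integral0_eq => y _.
  rewrite /fubini_G /=; apply: (line (fun x => ((x, y), t))).
  + by move=> x; exact: (cvg_pair (cvg_pair cvg_id (cvg_cst _)) (cvg_cst _)).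
  + by move=> h x; rewrite eE; congr ((_, _), _); rewrite /= ?scaler0 ?add0r// [h%:A]mulr1.
  + by move=> x nx [[]].
- apply: etrans (esym E21) _; apply: integral0_eq => t _.
  apply: etrans (esym (integral12_prod_meas1 (islice t))) _; apply: integral0_eq => x _.
  rewrite /fubini_F /=; apply: (line (fun y => ((x, y), t))).
  + by move=> y; exact: (cvg_pair (cvg_pair (cvg_cst _) cvg_id) (cvg_cst _)).
  + by move=> h y; rewrite eE; congr ((_, _), _); rewrite /= ?scaler0 ?add0r// [h%:A]mulr1.
  + by move=> y ny [[]].
- apply: etrans (esym E12) _; apply: integral0_eq => p _.
  rewrite /fubini_F /=; apply: (line (fun t => (p, t))).
  + by move=> t; exact: (cvg_pair (cvg_cst _) cvg_id).
  + move=> h t; case: p => x y; rewrite eE.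
    by congr ((_, _), _); rewrite /= ?scaler0 ?add0r// [h%:A]mulr1.
  + by move=> t nt [].
Qed.

End divergence_theorem.

(** * C^1 bump functions and primitives with compact support *)

Section bump_functions.
Context {R : realType}.
Local Notation mR := (measurableTypeR R).
Local Notation mu := (@lebesgue_measure R).
Implicit Types (a b x t : R) (n : nat).

Lemma C1at_id x : C1at (id : R -> R) x.
Proof. by apply: (@C1at_lin _ _ _ idfun) => y; exact: cvg_id. Qed.

Lemma C1at_inv (V : normedModType R) (f : V -> R) p :
  C1at f p -> f p != 0 -> C1at (fun y => (f y)^-1) p.
Proof.
move=> Cf f0; apply: (@C1at_comp_scalar _ _ f GRing.inv) => //.
  near=> t; apply: derivableV => //; near: t.
  exact: (open_nbhs_nbhs (conj (@open_neq _ 0) f0)).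
have E : \forall t \near f p, - t ^- 2 = derive1 GRing.inv t.
  near=> t; rewrite derive1E deriveV//.
    by rewrite derive_id /GRing.scale/= mulr1.
  near: t; exact: (open_nbhs_nbhs (conj (@open_neq _ 0) f0)).
rewrite /prop_for /continuous_at -(nbhs_singleton E).
apply: cvg_trans (near_eq_cvg E) _.
apply: cvgN; apply: cvgV; first by rewrite expf_neq0.
by rewrite expr2; apply: cvgM; exact: cvg_id.
Unshelve. all: by end_near. Qed.

(** Squaring makes the positive part C^1, which is the regularity required of the test functions. *)
Definition possq t : R := Num.max 0 t ^+ 2.

Lemma is_derive_possq t : is_derive t 1 possq (2 * Num.max 0 t).
Proof.
have [t0|t0|->] := ltgtP t 0.
- rewrite mulr0.
  apply: (@near_eq_is_derive R R R (cst 0) possq t 1 0).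
  near=> y; rewrite /possq max_l ?expr0n//; apply: ltW.
  by near: y; exact: lt_nbhsl.
- apply: (@near_eq_is_derive R R R (fun y => y ^+ 2)).
    near=> y; rewrite /possq max_r//; apply: ltW.
    by near: y; exact: lt_nbhsr.
  by apply: is_derive_eq; rewrite /GRing.scale/=; ring.
- rewrite mulr0.
  have H : h^-1 *: (possq (h *: 1 + 0) - possq 0) @[h --> 0^'] --> (0 : R).
    apply/cvgr0Pnorm_le => e e0.
    near=> h.
    rewrite [h *: 1]mulr1 addr0 /possq maxxx expr0n/= subr0 normrM normfV normrX.
    have h0 : 0 < `|h| by rewrite normr_gt0; near: h; exact: nbhs_dnbhs_neq.
    rewrite ler_pdivrMl//.
    have hm : `|Num.max 0 h| <= `|h|.
      by have [h1|h1] := leP 0 h; rewrite ?normr0.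
    rewrite expr2; apply: ler_pM => //; apply: (le_trans hm).
    by near: h; apply: dnbhs0_le.
  by split; [apply/cvg_ex; exists 0|exact/cvg_lim].
Unshelve. all: by end_near. Qed.

Lemma continuous_derive1_possq : continuous (derive1 possq).
Proof.
rewrite (_ : derive1 possq = (fun y => 2 * Num.max 0 y)).
  move=> t; apply: cvgM; first exact: cvg_cst.
  by apply: continuous_max; [exact: cvg_cst|exact: cvg_id].
by apply/funext => y; rewrite derive1E; have [_] := is_derive_possq y.
Qed.

(** This is [n P / (1 + n P)] with [P = possq ((x - a) * (b - x))]. For [a < b], [P] is positive
    exactly on the open interval, so these functions increase with [n] to its indicator. *)
Definition c1bump a b n x : R := 1 - (1 + n%:R * possq ((x - a) * (b - x)))^-1.

Lemma possq_ge0 t : 0 <= possq t.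
Proof. exact: sqr_ge0. Qed.

Let den_gt0 a b n x : 0 < 1 + n%:R * possq ((x - a) * (b - x)).
Proof. by rewrite ltr_pwDl// mulr_ge0// possq_ge0. Qed.

Lemma bump_ge0 a b n x : 0 <= c1bump a b n x.
Proof. by rewrite subr_ge0 invf_le1// lerDl mulr_ge0// possq_ge0. Qed.

Lemma bump_nd a b x m n : (m <= n)%N -> c1bump a b m x <= c1bump a b n x.
Proof.
move=> mn; rewrite lerB// lef_pV2 ?posrE//.
by rewrite lerD2l ler_wpM2r ?possq_ge0// ler_nat.
Qed.

Lemma bump_out a b n x : a < b -> ~~ (a < x < b) -> c1bump a b n x = 0.
Proof.
move=> ab axb; rewrite /c1bump.
suff -> : possq ((x - a) * (b - x)) = 0 by rewrite mulr0 addr0 invr1 subrr.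
rewrite /possq max_l ?expr0n//.
move: axb; rewrite negb_and -!leNgt => /orP[xa|bx]; nra.
Qed.

Lemma bump_cvg a b x : a < b -> c1bump a b n x @[n --> \oo] --> (\1_(`]a, b[%classic) x : R).
Proof.
move=> ab; rewrite indicE.
have [|xab] := boolP (x \in `]a, b[%classic); last first.
  rewrite (_ : (fun _ => _) = cst 0); first exact: cvg_cst.
  apply/funext => n; rewrite bump_out//; apply: contra xab.
  by rewrite inE/= in_itv.
rewrite inE/= in_itv/= => /andP[ax xb].
set p := possq ((x - a) * (b - x)).
have p0 : 0 < p.
  by rewrite exprn_gt0// lt_max; apply/orP; right; rewrite mulr_gt0// subr_gt0.
rewrite -[X in _ --> X]subr0; apply: cvgB; first exact: cvg_cst.
apply/cvgr0Pnorm_le => e e0.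
near=> n.
rewrite ger0_norm ?invr_ge0 ?(ltW (den_gt0 _ _ _ _))//.
rewrite -[e]invrK lef_pV2 ?posrE ?invr_gt0//.
apply: (@le_trans _ _ (n%:R * p)); last by rewrite lerDr.
rewrite -ler_pdivrMr//.
by near: n; exact: nbhs_infty_ger.
Unshelve. all: by end_near. Qed.

Lemma C1at_bump a b n x : C1at (c1bump a b n) x.
Proof.
have C0 : C1at (fun y : R => (y - a) * (b - y)) x.
  have C1 : C1at (fun y : R => y - a) x by exact: (C1atD (C1at_id x) (C1at_cst (- a) x)).
  have CN : C1at (fun y : R => - 1 * y) x.
    exact: (C1atM (C1at_cst (-1 : R) x) (C1at_id x)).
  have Cm : C1at (fun y : R => b + - 1 * y) x by exact: (C1atD (C1at_cst b x) CN).
  apply: C1at_near_eq (C1atM C1 Cm).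
  by apply: filterE => y /=; rewrite mulN1r.
have Cp : C1at (fun y : R => possq ((y - a) * (b - y))) x.
  apply: (@C1at_comp_scalar _ _ (fun y : R => (y - a) * (b - y)) possq) => //.
    by apply: filterE => t; have [] := is_derive_possq t.
  exact: continuous_derive1_possq.
have Cd : C1at (fun y : R => 1 + n%:R * possq ((y - a) * (b - y))) x.
  have Cn := C1atM (C1at_cst (n%:R : R) x) Cp.
  exact: (C1atD (C1at_cst (1 : R) x) Cn).
have Ci := C1at_inv Cd (lt0r_neq0 (den_gt0 a b n x)).
have CN := C1atM (C1at_cst (-1 : R) x) Ci.
have := C1atD (C1at_cst (1 : R) x) CN.
by apply: C1at_near_eq; apply: filterE => y /=; rewrite mulN1r.
Qed.

Lemma continuous_bump a b n : continuous (c1bump a b n).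
Proof. by move=> x; exact: (C1at_continuous (C1at_bump a b n x)). Qed.

Lemma measurable_bump a b n : measurable_fun setT (c1bump a b n).
Proof. by apply: continuous_measurable_fun; exact: continuous_bump. Qed.

Lemma integral_bump_cvg a b : a < b ->
  (\int[mu]_x (c1bump a b n x)%:E @[n --> \oo] --> (b - a)%:E)%E.
Proof.
move=> ab.
have <- : (\int[mu]_x (\1_(`]a, b[%classic) x)%:E = (b - a)%:E)%E.
  rewrite integral_indic// setIT; apply: etrans (lebesgue_measure_itv `]a, b[) _.
  by rewrite /= lte_fin ab.
rewrite (_ : (fun x => _) = (fun x => limn (fun n => (c1bump a b n x)%:E))); last first.
  apply/funext => x; apply/esym/cvg_lim => //.
  by apply: cvg_EFin; [exact: nearW|exact: bump_cvg].
apply: cvg_monotone_convergence => //.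
- by move=> n; apply/measurable_EFinP; exact: measurable_bump.
- by move=> n x _; rewrite lee_fin bump_ge0.
- by move=> x _ m n mn; rewrite lee_fin bump_nd.
Qed.

Lemma integrable_continuous_support (eta : R -> R) a b : continuous eta ->
  (forall x, ~~ (a < x < b) -> eta x = 0) -> mu.-integrable setT (EFin \o eta).
Proof.
move=> ceta eta0.
have : mu.-integrable `[a, b] (EFin \o eta).
  apply: continuous_compact_integrable; first exact: segment_compact.
  exact: continuous_subspaceT.
rewrite integrable_mkcond// (_ : _ \_ _ = EFin \o eta)//.
apply/funext => x; rewrite patchE; case: ifPn => //.
rewrite notin_setE/= in_itv/= => /negP xab; rewrite eta0//.
by apply: contra xab => /andP[/ltW-> /ltW->].
Qed.

(** The integrals of the bumps tend to [b - a > 0], so one of them is nonzero, and that bump can be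
    normalized. *)
Lemma ex_unit_bump a b : a < b -> exists eta : R -> R,
  [/\ continuous eta, forall x, 0 <= eta x,
      forall x, ~~ (a < x < b) -> eta x = 0
    & (\int[mu]_x (eta x)%:E = 1)%E].
Proof.
move=> ab.
have [n In0] : exists n, (\int[mu]_x (c1bump a b n x)%:E)%E != 0%E.
  apply: contrapT => /forallNP h0.
  have h n : (\int[mu]_x (c1bump a b n x)%:E = 0)%E by have /negP/negPn/eqP := h0 n.
  have := integral_bump_cvg ab; rewrite (_ : (fun _ => _) = cst 0%E); last first.
    by apply/funext => n; rewrite h.
  move/(cvg_unique (@ereal_hausdorff R) (cvg_cst _)) => -[] /eqP.
  by rewrite eq_sym subr_eq0 gt_eqF.
have ib : mu.-integrable setT (EFin \o c1bump a b n).
  apply: (@integrable_continuous_support _ a b); first exact: continuous_bump.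
  by move=> x; exact: bump_out.
pose I := fine (\int[mu]_x (c1bump a b n x)%:E).
have IE : (\int[mu]_x (c1bump a b n x)%:E = I%:E)%E.
  by rewrite fineK//; exact: integrable_fin_num ib.
have I0 : 0 < I.
  rewrite lt0r -lee_fin -IE integral_ge0 ?andbT; last by move=> x _; rewrite lee_fin bump_ge0.
  by apply: contraNneq In0 => I0; rewrite IE I0.
exists (fun x => I^-1 * c1bump a b n x); split.
- move=> x; apply: cvgM; first exact: cvg_cst.
  exact: continuous_bump.
- by move=> x; rewrite mulr_ge0 ?bump_ge0// invr_ge0 ltW.
- by move=> x xab; rewrite bump_out// mulr0.
- under eq_integral do rewrite EFinM.
  rewrite integralZl// IE -EFinM mulVf//.
  by rewrite gt_eqF.
Qed.

(** The primitive starting at minus infinity vanishes to the left of [a], and to the right of [b]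
    because there it equals the total integral of [eta]. *)
Lemma ex_primitive (eta : R -> R) a b : a < b -> continuous eta ->
  (forall x, ~~ (a < x < b) -> eta x = 0) ->
  (\int[mu]_x (eta x)%:E = 0)%E ->
  exists alpha : R -> R, [/\ forall x, derivable alpha x 1, derive1 alpha = eta
    & forall x, ~~ (a < x < b) -> alpha x = 0].
Proof.
move=> ab ceta eta0 int0.
have ieta : mu.-integrable setT (EFin \o eta).
  exact: integrable_continuous_support ceta eta0.
pose alpha x := (\int[mu]_(t in `]-oo, x]) eta t)%R.
have D x : derivable alpha x 1 /\ derive1 alpha x = eta x.
  have x1 : x < x + 1 by rewrite ltrDl.
  apply: (@continuous_FTC1 _ eta -oo%O x (x + 1) x1).
  - exact: integrableS ieta.
  - by rewrite ltNyr.
  - exact: ceta.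
exists alpha; split => [x| |x xab].
- by have [] := D x.
- by apply/funext => x; have [] := D x.
rewrite /alpha /Rintegral.
have [xa|ax] := leP x a.
  rewrite integral0_eq// => t /=; rewrite in_itv/= => tx.
  by rewrite eta0// negb_and -!leNgt (le_trans tx xa).
have bx : b <= x by move: xab; rewrite ax/= -leNgt.
rewrite (_ : (\int[mu]_(t in `]-oo, x]) (eta t)%:E = 0)%E)// -[RHS]int0.
rewrite integral_mkcond; apply: eq_integral => t _; rewrite patchE.
case: ifPn => //; rewrite notin_setE/= in_itv/= => /negP; rewrite -ltNge => xt.
by rewrite eta0// negb_and -!leNgt (le_trans bx (ltW xt)) orbT.
Qed.

End bump_functions.

(** * Divergences supported in a compact subset of an open set *)

Section divergence_open.
Context {R : realType}.
Local Notation mR := (measurableTypeR R).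
Local Notation H := (R * R * R)%type.
Local Notation mH := (mR * mR * mR)%type.

(** A point of [O] has a neighbourhood on which the extension by zero is [f]; any other point has
    one that avoids the closed set [K], on which the extension is zero. *)
Lemma C1at_restrict (V : normedModType R) (O K : set V) (f : V -> R) :
  open O -> closed K -> K `<=` O -> (forall x, O x -> C1at f x) ->
  (forall x, O x -> ~ K x -> f x = 0) ->
  (forall x, C1at (f \_ O) x) /\ (forall v x, 'D_v (f \_ O) x = ('D_v f \_ O) x).
Proof.
move=> oO cK KO Cf f0.
have nO x : O x -> \forall y \near x, f y = (f \_ O) y.
  move=> Ox; have := open_nbhs_nbhs (conj oO Ox).
  by apply: filterS => y Oy; rewrite patchE mem_set.
have nK x : ~ O x -> \forall y \near x, cst 0 y = (f \_ O) y.
  move=> Ox; have : nbhs x (~` K).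
    by apply: open_nbhs_nbhs; split; [exact: closed_openC|move/KO].
  apply: filterS => y Ky; rewrite patchE; case: ifPn => // /set_mem Oy.
  by rewrite f0.
split=> [x|v x]; have [Ox|Ox] := pselect (O x).
- exact: C1at_near_eq (nO _ Ox) (Cf _ Ox).
- exact: C1at_near_eq (nK _ Ox) (C1at_cst _ _).
- by rewrite -(near_eq_derive v (nO _ Ox)) patchE mem_set.
- by rewrite -(near_eq_derive v (nK _ Ox)) derive_cst patchE memNset.
Qed.

Lemma compact_cube (K : set H) : compact K -> exists2 n : R, 0 < n &
  K `<=` (`[- n, n] `*` `[- n, n]) `*` `[- n, n].
Proof.
move=> cK; have [M [_ hM]] := compact_bounded cK.
exists (`|M| + 1); first by rewrite ltr_pwDr.
move=> [[x y] t] Kp.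
have : `|((x, y), t)| <= `|M| + 1.
  by apply: hM => //; rewrite (le_lt_trans (ler_norm _))// ltrDl.
rewrite prod_normE/= ge_max => /andP[]; rewrite prod_normE/= ge_max => /andP[].
by rewrite !ler_norml; split; [split|]; rewrite /= in_itv.
Qed.

(** The boundary of [O] plays no part: extended by zero, each component is a C^1 function with
    compact support on the whole space. *)
Lemma integral_divergence_eq0 (O K : set H) (f1 f2 f3 : H -> R) :
  open O -> compact K -> K `<=` O ->
  (forall x, O x -> [/\ C1at f1 x, C1at f2 x & C1at f3 x]) ->
  (forall x, O x -> ~ K x -> [/\ f1 x = 0, f2 x = 0 & f3 x = 0]) ->
  (\int[lebesgue3 R]_(p in (O : set mH)) ('D_((1, 0), 0) f1 p + 'D_((0, 1), 0) f2 p
     + 'D_((0, 0), 1) f3 p)%:E = 0)%E.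
Proof.
move=> oO cK KO Cf f0.
have clK : closed K by apply: compact_closed => //; exact: norm_hausdorff.
have [n n0 Kn] := compact_cube cK.
have main (f : H -> R) e : e \in [:: ((1, 0), 0); ((0, 1), 0); ((0, 0), 1)] ->
    (forall x, O x -> C1at f x) -> (forall x, O x -> ~ K x -> f x = 0) ->
    (lebesgue3 R).-integrable setT (EFin \o ('D_e f \_ O)) /\
    (\int[lebesgue3 R]_p (('D_e f \_ O) p)%:E = 0)%E.
  move=> he Cf' f0'.
  have [CF DF] := C1at_restrict oO clK KO Cf' f0'.
  rewrite (_ : 'D_e f \_ O = 'D_e (f \_ O)); last by apply/funext => x; rewrite DF.
  apply: (integral_derive_eq0 n0 he CF) => p np.
  rewrite patchE; case: ifPn => // /set_mem Op.
  by rewrite f0'// => /Kn.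
have [i1 e1] : _ := main f1 ((1, 0), 0) (mem_head _ _) (fun x Ox => let: And3 h _ _ := Cf x Ox in h)
   (fun x Ox Kx => let: And3 h _ _ := f0 x Ox Kx in h).
have [|i2 e2] : _ := main f2 ((0, 1), 0) _ (fun x Ox => let: And3 _ h _ := Cf x Ox in h)
   (fun x Ox Kx => let: And3 _ h _ := f0 x Ox Kx in h).
  by rewrite !inE eqxx orbT.
have [|i3 e3] : _ := main f3 ((0, 0), 1) _ (fun x Ox => let: And3 _ _ h := Cf x Ox in h)
   (fun x Ox Kx => let: And3 _ _ h := f0 x Ox Kx in h).
  by rewrite !inE eqxx !orbT.
transitivity (\int[lebesgue3 R]_p ((('D_((1, 0), 0) f1 \_ O) p)%:E +
  (('D_((0, 1), 0) f2 \_ O) p)%:E + (('D_((0, 0), 1) f3 \_ O) p)%:E))%E.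
  rewrite [LHS]integral_mkcond.
  apply: eq_integral => x _.
  by rewrite !patchE; case: ifPn => //; rewrite !add0r.
have i12 := integrableD measurableT i1 i2.
rewrite (integralD measurableT i12 i3) (integralD measurableT i1 i2).
by rewrite /= e1 e2 e3 !adde0.
Qed.

End divergence_open.

(** * The flow along the leaves *)

Section foliation.
Context {R : realType}.
Local Notation mR := (measurableTypeR R).
Local Notation H := (R * R * R)%type.
Local Notation X := (R * (R * R))%type.
Local Notation mH := (mR * mR * mR)%type.
Local Notation mX := (mR * (mR * mR))%type.

Lemma open_setX (T U : topologicalType) (A : set T) (B : set U) :
  open A -> open B -> open (A `*` B).
Proof.
move=> oA oB; rewrite openE => -[x y] [Ax By]; exists (A, B); last by [].
by split; exact: open_nbhs_nbhs.
Qed.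

Lemma derive1_mulr_cst (f : R -> R) (k t : R) : derivable f t 1 ->
  derive1 (fun s => f s * k) t = derive1 f t * k.
Proof.
move=> /derivable1_diffP df; rewrite !derive1E.
rewrite (derive_mul_fun _ df (differentiable_cst k t)).
by rewrite derive_cst mulr0 add0r mulrC.
Qed.

Lemma C1atB (V W : normedModType R) (f1 f2 : V -> W) x :
  C1at f1 x -> C1at f2 x -> C1at (fun y => f1 y - f2 y) x.
Proof.
move=> C1 C2; apply: (C1atD C1).
apply: (@C1at_lin_comp _ _ _ _ -%R f2 x _ C2).
exact: opp_continuous.
Qed.

Lemma C1at_rsqrt (V : normedModType R) (f : V -> R) x :
  C1at f x -> 0 < f x -> C1at (fun y => (Num.sqrt (f y))^-1) x.
Proof.
move=> Cf f0; apply: (@C1at_inv _ V (fun y => Num.sqrt (f y))); last first.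
  by rewrite gt_eqF// sqrtr_gt0.
have E : \forall t \near f x, (2 * Num.sqrt t)^-1 = derive1 Num.sqrt t.
  near=> t; rewrite derive1E; have t0 : 0 < t by near: t; exact: lt_nbhsr.
  by have [_ ->] := is_derive1_sqrt t0.
apply: (@C1at_comp_scalar _ _ f Num.sqrt) => //.
  near=> t; have t0 : 0 < t by near: t; exact: lt_nbhsr.
  by have [] := is_derive1_sqrt t0.
rewrite /prop_for /continuous_at -(nbhs_singleton E).
apply: cvg_trans (near_eq_cvg E) _.
apply: cvgV; first by rewrite mulf_neq0// gt_eqF// sqrtr_gt0.
by apply: cvgM; [exact: cvg_cst|exact: sqrt_continuous].
Unshelve. all: by end_near. Qed.

Lemma C1at_Ck2 (V W : normedModType R) (A : set V) (f : V -> W) x :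
  open A -> Ck_on 2 A f -> A x -> C1at f x.
Proof.
move=> oA [df cf] Ax; apply: (C1at_Ck_on oA _ Ax); split => // v y Ay.
by have [dDf _] := cf v; exact/differentiable_continuous/dDf.
Qed.

Lemma C1at_derive_Ck2 (V W : normedModType R) (A : set V) (f : V -> W) x v :
  open A -> Ck_on 2 A f -> A x -> C1at ('D_v f) x.
Proof. by move=> oA [_ cf] Ax; exact: (C1at_Ck_on oA (cf v) Ax). Qed.

Variables (Omega : set H) (I : set R) (Lambda : set (R * R)).
Variables (Phi : X -> H) (g : H -> X) (q : H -> R[i]).
Hypotheses (oOmega : open Omega) (oI : open I) (oLambda : open Lambda).
Hypothesis CPhi : Ck_on 2 (I `*` Lambda) Phi.
Hypothesis Cg : Ck_on 2 Omega g.
Hypothesis PhiK : forall z, (I `*` Lambda) z -> Omega (Phi z) /\ g (Phi z) = z.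
Hypothesis gK : forall x, Omega x -> (I `*` Lambda) (g x) /\ Phi (g x) = x.
Let leaf p := Curve I (fun s => Phi (s, p)).
Hypothesis leaf_legendrian : forall p, Lambda p -> legendrian (leaf p).
Hypothesis leaf_horizontal : forall p s, Lambda p -> I s ->
  0 < q (Phi (s, p)) * curve_dz (leaf p) s ^+ 2.
Hypothesis smooth_q : quadratic_differential Omega q.
Hypothesis B2q : forall x, Omega x -> B2 q x = 0.

Let e1 : X := (1, (0, 0)).
Definition leaf_velocity (z : X) : H := 'D_e1 Phi z.

Let oIL : open (I `*` Lambda).
Proof. exact: open_setX. Qed.

Let C1Phi z : (I `*` Lambda) z -> C1at Phi z.
Proof. exact: C1at_Ck2 oIL CPhi. Qed.

Let C1g x : Omega x -> C1at g x.
Proof. exact: C1at_Ck2 oOmega Cg. Qed.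

Let line_e1 (p : R * R) (s : R) h : ((h + s, p) : X) = h *: e1 + (s, p).
Proof. by case: p => a b; congr (_, (_, _)); rewrite /= ?scaler0 ?add0r// [h%:A]mulr1. Qed.

Let leaf_derive (V : normedModType R) (L : H -> V) s p : (I `*` Lambda) (s, p) ->
  differentiable (L \o Phi) (s, p) ->
  derive1 (fun u => L (Phi (u, p))) s = 'D_e1 (L \o Phi) (s, p).
Proof.
move=> Isp dL.
have dL1 : derivable (L \o Phi) (s, p) e1 by exact: diff_derivable.
have [_] := @derive_line _ _ _ (L \o Phi) (fun t => (t, p)) e1 s (line_e1 p s) dL1.
exact.
Qed.

Lemma curve_dzE s p : I s -> Lambda p -> curve_dz (leaf p) s =
  Complex (leaf_velocity (s, p)).1.1 (leaf_velocity (s, p)).1.2.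
Proof.
move=> Is Lp; have Isp : (I `*` Lambda) (s, p) by [].
have CP := C1Phi Isp; have CP1 := C1at_fst CP.
have dP := C1at_differentiable CP; have dP1 := C1at_differentiable CP1.
rewrite /curve_dz /= (leaf_derive (L := fun x => x.1.1) Isp); last first.
  exact: C1at_differentiable (C1at_fst CP1).
rewrite (leaf_derive (L := fun x => x.1.2) Isp); last first.
  exact: C1at_differentiable (C1at_snd CP1).
by rewrite (derive_fst _ dP1) (derive_snd _ dP1) (derive_fst _ dP).
Qed.

Lemma curve_dtE s p : I s -> Lambda p -> curve_dt (leaf p) s =
  (leaf_velocity (s, p)).2.
Proof.
move=> Is Lp; have Isp : (I `*` Lambda) (s, p) by [].
have CP := C1Phi Isp; have dP := C1at_differentiable CP.
rewrite /curve_dt /tc /= (leaf_derive (L := snd) Isp); last first.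
  exact: C1at_differentiable (C1at_snd CP).
exact: derive_snd.
Qed.

Let u x := complex.Re (q x).
Let v x := complex.Im (q x).
Let N x := u x ^+ 2 + v x ^+ 2.
Let c x := (leaf_velocity (g x)).1.1.
Let d x := (leaf_velocity (g x)).1.2.

(* The number [q dz^2] of the velocity of the leaf through [x], which is real. *)
Let r x := u x * (c x * c x - d x * d x) - 2 * (v x * (c x * d x)).

(** On a horizontal leaf [r] is the modulus of [q dz^2] on the velocity, that is
    [|q| |d gamma_1 / ds|^2], so this is [|q|^(3/2) / |d gamma_1 / ds|]. Written with [r] it is seen
    to be C^1, since [r] is a polynomial in C^1 functions and is positive. *)
Definition flow_density x : R := N x * (Num.sqrt (r x))^-1.

Let h := flow_density.
Let a x := h x * c x.
Let b x := h x * d x.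

Lemma r_gt0 x : Omega x ->
  0 < r x /\ 2 * (u x * (c x * d x)) + v x * (c x * c x - d x * d x) = 0.
Proof.
move=> Ox; have [[Is Lp] gx] := gK Ox.
have := leaf_horizontal Lp Is; rewrite curve_dzE// -surjective_pairing gx.
rewrite /r /u /v /c /d.
case: (q x) => U V; rewrite expr2/= ltcE/= => /andP[/eqP h1 h2]; split.
  by apply: lt_le_trans h2 _; rewrite le_eqVlt; apply/orP; left; apply/eqP; ring.
by rewrite -[RHS]h1; ring.
Qed.

(** The legendrian condition at [Phi (g x) = x]: the velocity is [c hX + d hY]. *)
Lemma leaf_velocity_t x : Omega x ->
  (leaf_velocity (g x)).2 = 2 * x.1.2 * c x - 2 * x.1.1 * d x.
Proof.
move=> Ox; have [[Is Lp] gx] := gK Ox.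
have [_ _ /(_ _ Is)] := leaf_legendrian Lp.
rewrite curve_dtE// curve_dzE// -surjective_pairing => ->.
rewrite /curve_z/= -surjective_pairing gx /zc /c /d /=.
by ring.
Qed.

Let C1u x : Omega x -> C1at u x.
Proof. by move=> Ox; have [+ _] := smooth_q 1; move/(C1at_Ck_on oOmega); apply. Qed.

Let C1v x : Omega x -> C1at v x.
Proof. by move=> Ox; have [_] := smooth_q 1; move/(C1at_Ck_on oOmega); apply. Qed.

(** The second derivatives of [Phi] enter here: the velocity must be C^1 for the flow field to have
    a divergence. *)
Let C1_leaf_velocity x : Omega x -> C1at leaf_velocity (g x).
Proof. by move=> Ox; apply: (C1at_derive_Ck2 _ oIL CPhi); have [] := gK Ox. Qed.

Let C1c x : Omega x -> C1at c x.
Proof.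
move=> Ox; apply: (@C1at_comp _ _ g (fun z => (leaf_velocity z).1.1)).
  exact: C1g.
exact: C1at_fst (C1at_fst (C1_leaf_velocity Ox)).
Qed.

Let C1d x : Omega x -> C1at d x.
Proof.
move=> Ox; apply: (@C1at_comp _ _ g (fun z => (leaf_velocity z).1.2)).
  exact: C1g.
exact: C1at_snd (C1at_fst (C1_leaf_velocity Ox)).
Qed.

Lemma C1at_flow_density x : Omega x -> C1at h x.
Proof.
move=> Ox; have Cc := C1c Ox; have Cd := C1d Ox; have Cu := C1u Ox.
have Cv := C1v Ox.
have Cr : C1at r x.
  apply: C1atB (C1atM Cu (C1atB (C1atM Cc Cc) (C1atM Cd Cd))) _.
  exact: C1atM (C1at_cst (2 : R) x) (C1atM Cv (C1atM Cc Cd)).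
have CN : C1at N x by exact: C1atD (C1atM Cu Cu) (C1atM Cv Cv).
exact: C1atM CN (C1at_rsqrt Cr (r_gt0 Ox).1).
Qed.

Let C1a x : Omega x -> C1at a x.
Proof. by move=> Ox; exact: C1atM (C1at_flow_density Ox) (C1c Ox). Qed.

Let C1b x : Omega x -> C1at b x.
Proof. by move=> Ox; exact: C1atM (C1at_flow_density Ox) (C1d Ox). Qed.

Lemma N_gt0 x : Omega x -> 0 < N x.
Proof.
move=> Ox; have [r0 _] := r_gt0 Ox.
rewrite lt0r addr_ge0 ?sqr_ge0// andbT; apply/negP => /eqP N0.
have [u0 v0] : u x = 0 /\ v x = 0.
  move/eqP: N0; rewrite paddr_eq0 ?sqr_ge0// !sqrf_eq0.
  by move=> /andP[/eqP-> /eqP->].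
by move: r0; rewrite /r u0 v0 !mul0r mulr0 subr0 ltxx.
Qed.

Lemma flow_density_gt0 x : Omega x -> 0 < h x.
Proof.
by move=> Ox; rewrite mulr_gt0 ?N_gt0// invr_gt0 sqrtr_gt0; have [] := r_gt0 Ox.
Qed.

Let h_sqr x : Omega x -> h x ^+ 2 * r x = N x ^+ 2.
Proof.
move=> Ox; have [r0 _] := r_gt0 Ox.
rewrite /h /flow_density exprMn exprVn sqr_sqrtr ?(ltW r0)// mulfVK//.
by rewrite gt_eqF.
Qed.

Let ab_gt0 x : Omega x -> 0 < a x ^+ 2 + b x ^+ 2.
Proof.
move=> Ox; have [r0 _] := r_gt0 Ox; have h0 := flow_density_gt0 Ox.
rewrite lt0r addr_ge0 ?sqr_ge0// andbT; apply/negP => /eqP ab0.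
have [c0 d0] : c x = 0 /\ d x = 0.
  have hn : h x != 0 by rewrite gt_eqF.
  move/eqP: ab0; rewrite paddr_eq0 ?sqr_ge0// !sqrf_eq0 => /andP[/eqP a0 /eqP b0].
  by split; apply: (mulfI hn); rewrite mulr0.
by move: r0; rewrite /r c0 d0 !mul0r subrr !mulr0 subrr ltxx.
Qed.

(** Here and in [w_sqr_im], with [w = a + i b]: [w^2 r = h^2 r (c + i d)^2 = N^2 (c + i d)^2 = N
    conj(q) q (c + i d)^2 = N conj(q) r], because [q (c + i d)^2 = r]. Cancelling [r] leaves
    [w^2 = N conj(q)], of which this is the real part. *)
Let w_sqr_re x : Omega x -> a x ^+ 2 - b x ^+ 2 = N x * u x.
Proof.
move=> Ox; have [r0 i0] := r_gt0 Ox; have h2 := h_sqr Ox.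
apply: (mulIf (lt0r_neq0 r0)).
transitivity ((h x ^+ 2 * r x) * (c x * c x - d x * d x)); first by rewrite /a /b; ring.
rewrite h2; transitivity (N x * u x * r x + N x * v x *
    (2 * (u x * (c x * d x)) + v x * (c x * c x - d x * d x))).
  by rewrite /r /N; ring.
by rewrite i0 mulr0 addr0.
Qed.

Let w_sqr_im x : Omega x -> 2 * a x * b x = - (N x * v x).
Proof.
move=> Ox; have [r0 i0] := r_gt0 Ox; have h2 := h_sqr Ox.
apply: (mulIf (lt0r_neq0 r0)).
transitivity ((h x ^+ 2 * r x) * (2 * (c x * d x))); first by rewrite /a /b; ring.
rewrite h2; transitivity (- (N x * v x) * r x + N x * u x *
    (2 * (u x * (c x * d x)) + v x * (c x * c x - d x * d x))).
  by rewrite /r /N; ring.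
by rewrite i0 mulr0 addr0.
Qed.

Let div_flow x : Omega x -> 'D_(hX x) a x + 'D_(hY x) b x = 0.
Proof.
move=> Ox.
have du := C1at_differentiable (C1u Ox); have dv := C1at_differentiable (C1v Ox).
have [h1 h2] := B2_eq0 du dv (B2q Ox).
have nO := open_nbhs_nbhs (conj oOmega Ox).
apply: (divergence_free (C1at_differentiable (C1a Ox))
  (C1at_differentiable (C1b Ox)) du dv _ _ (ab_gt0 Ox) h1 h2).
  by apply: filterS nO => y; exact: w_sqr_re.
by apply: filterS nO => y; exact: w_sqr_im.
Qed.

(** The field [a hX + b hY] in coordinates. *)
Let flow_field x : H := ((a x, b x), 2 * x.1.2 * a x - 2 * x.1.1 * b x).

Let flow_fieldE x : Omega x -> flow_field x = h x *: leaf_velocity (g x).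
Proof.
move=> Ox; rewrite /flow_field [RHS]surjective_pairing [(_ *: _).1]surjective_pairing.
congr ((_, _), _) => //=; rewrite leaf_velocity_t// /a /b /GRing.scale/=.
by ring.
Qed.

(** The field is [h] times the leaf velocity, and differentiating [g \o Phi = id] along the leaf
    shows that [g] sends this velocity to [e1]. *)
Let derive_g_flow x : Omega x -> 'D_(flow_field x) g x = h x *: e1.
Proof.
move=> Ox; have [ILg gx] := gK Ox.
have dg := C1at_differentiable (C1g Ox).
have dP := C1at_differentiable (C1Phi ILg).
rewrite flow_fieldE// deriveE// linearZ -deriveE//; congr (_ *: _).
have dg' : differentiable g (Phi (g x)) by rewrite gx.
transitivity ('D_e1 (g \o Phi) (g x)); first by rewrite (derive_comp e1 dP dg') gx.
transitivity ('D_e1 id (g x)); last exact: derive_id.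
apply: near_eq_derive.
by apply: filterS (open_nbhs_nbhs (conj oIL ILg)) => z /PhiK[].
Qed.

(** The invariance in weak form. Let [V] be [flow_field] and [psi = T \o g], with [T] the product of
    [alpha], [beta] and [gamma] in the leaf coordinates. As [div V = 0], the divergence of [psi V]
    is [V psi], which is [h] times the [s]-derivative of [T] at [g x]; as [psi V] has compact
    support in [Omega], its integral vanishes. *)
Lemma integral_flow_eq0 (alpha beta gamma : R -> R) (j k c1 d1 c2 d2 : R) :
  (forall t, derivable alpha t 1) -> continuous (derive1 alpha) ->
  (forall t, C1at beta t) -> (forall t, C1at gamma t) ->
  `[j, k] `*` (`[c1, d1] `*` `[c2, d2]) `<=` I `*` Lambda ->
  (forall t, ~~ (j < t < k) -> alpha t = 0) ->
  (forall t, ~~ (c1 < t < d1) -> beta t = 0) ->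
  (forall t, ~~ (c2 < t < d2) -> gamma t = 0) ->
  (\int[lebesgue3 R]_(x in (Omega : set mH))
     (derive1 alpha (g x).1 * (beta (g x).2.1 * gamma (g x).2.2) * h x)%:E = 0)%E.
Proof.
move=> dalpha calpha Cbeta Cgamma sub alpha0 beta0 gamma0.
set B := `[j, k] `*` (`[c1, d1] `*` `[c2, d2]) in sub.
pose T (z : X) := alpha z.1 * (beta z.2.1 * gamma z.2.2).
have CT z : C1at T z.
  have C1 : C1at (fun z : X => z.1) z.
    by apply: C1at_fst; apply: (@C1at_lin _ _ _ idfun) => y; exact: cvg_id.
  have C2 : C1at (fun z : X => z.2) z.
    by apply: C1at_snd; apply: (@C1at_lin _ _ _ idfun) => y; exact: cvg_id.
  have Ca : C1at (alpha \o fst) z.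
    apply: (@C1at_comp_scalar _ _ (fun z : X => z.1) alpha z C1); last exact: calpha.
    exact: filterE.
  have comp (f : X -> R) (k' : R -> R) : C1at f z -> (forall t, C1at k' t) -> C1at (k' \o f) z.
    move=> Cf Ck; apply: C1at_comp_scalar => //.
      by apply: filterE => t; exact: C1at_derivable.
    have -> : derive1 k' = 'D_1 k' by apply/funext => t; rewrite derive1E.
    by have [_] := Ck (f z); exact.
  have Cb := comp (fun z => z.2.1) beta (C1at_fst C2) Cbeta.
  have Cc := comp (fun z => z.2.2) gamma (C1at_snd C2) Cgamma.
  exact: (C1atM Ca (C1atM Cb Cc)).
pose psi := T \o g.
have Cpsi x : Omega x -> C1at psi x.
  by move=> Ox; apply: C1at_comp => //; exact: C1g.
have cB : compact B.
  by do 2 (apply: compact_setX; first exact: segment_compact); exact: segment_compact.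
have cK : compact (Phi @` B).
  apply: continuous_compact => //; apply: continuous_in_subspaceT => z /set_mem Bz.
  exact: C1at_continuous (C1Phi (sub _ Bz)).
have KO : Phi @` B `<=` Omega by move=> _ [z /sub Bz <-]; have [] := PhiK Bz.
have psi0 x : Omega x -> ~ (Phi @` B) x -> psi x = 0.
  move=> Ox nK; have [_ gx] := gK Ox; rewrite /psi/= /T.
  apply/eqP; apply: contra_notT nK; rewrite !mulf_eq0 !negb_or => /and3P[a0 b0 c0].
  exists (g x) => //; split; [|split].
  - by apply/subset_itv_oo_cc; rewrite /= in_itv/=; apply: contraNT a0 => /alpha0 ->.
  - by apply/subset_itv_oo_cc; rewrite /= in_itv/=; apply: contraNT b0 => /beta0 ->.
  - by apply/subset_itv_oo_cc; rewrite /= in_itv/=; apply: contraNT c0 => /gamma0 ->.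
pose m x := 2 * x.1.2 * a x - 2 * x.1.1 * b x.
have Cid (x : H) : C1at (id : H -> H) x by apply: (@C1at_lin _ _ _ idfun) => y; exact: cvg_id.
pose cx (x : H) := 2 * x.1.1; pose cy (x : H) := 2 * x.1.2.
have Ccx x : C1at cx x by exact: C1atM (C1at_cst (2 : R) x) (C1at_fst (C1at_fst (Cid x))).
have Ccy x : C1at cy x by exact: C1atM (C1at_cst (2 : R) x) (C1at_snd (C1at_fst (Cid x))).
have Cm x : Omega x -> C1at m x.
  by move=> Ox; exact: C1atB (C1atM (Ccy x) (C1a Ox)) (C1atM (Ccx x) (C1b Ox)).
have DT z : 'D_e1 T z = derive1 alpha z.1 * (beta z.2.1 * gamma z.2.2).
  case: z => t p; have dT : derivable T (t, p) e1 by exact: C1at_derivable.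
  have [_ E] := @derive_line _ _ _ T (fun s => (s, p)) e1 t (line_e1 p t) dT.
  apply: etrans (esym E) _.
  exact: (derive1_mulr_cst (beta p.1 * gamma p.2) (dalpha t)).
have Dpsi x : Omega x -> 'D_(flow_field x) psi x =
    h x * (derive1 alpha (g x).1 * (beta (g x).2.1 * gamma (g x).2.2)).
  move=> Ox; have dT := C1at_differentiable (CT (g x)).
  rewrite (derive_comp _ (C1at_differentiable (C1g Ox)) dT) derive_g_flow//.
  by rewrite -DT deriveE// linearZ -deriveE.
have := @integral_divergence_eq0 R Omega (Phi @` B) (fun x => a x * psi x)
  (fun x => b x * psi x) (fun x => m x * psi x) oOmega cK KO.
move=> <-; first last.
- by move=> x Ox /(psi0 _ Ox) p0; rewrite p0 !mulr0.
- move=> x Ox; split; [exact: C1atM (C1a Ox) (Cpsi _ Ox)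
    |exact: C1atM (C1b Ox) (Cpsi _ Ox)|exact: C1atM (Cm _ Ox) (Cpsi _ Ox)].
apply: eq_integral => x /set_mem Ox; congr (_%:E).
have da := C1at_differentiable (C1a Ox); have db := C1at_differentiable (C1b Ox).
have dm := C1at_differentiable (Cm _ Ox).
have dpsi := C1at_differentiable (Cpsi _ Ox).
rewrite !(derive_mul_fun _ _ dpsi)//.
(* The coefficients [2 y] and [2 x] in the [t]-component [m] do not depend on [t]; hence the
   coordinate divergence of the field is exactly [hX a + hY b]. *)
have Dm : 'D_((0, 0), 1) m x = 2 * x.1.2 * 'D_((0, 0), 1) a x - 2 * x.1.1 * 'D_((0, 0), 1) b x.
  have dcx := C1at_differentiable (Ccx x); have dcy := C1at_differentiable (Ccy x).
  rewrite (derive_sub_fun _ (differentiable_mul_fun dcy da) (differentiable_mul_fun dcx db)).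
  rewrite (derive_mul_fun _ dcy da) (derive_mul_fun _ dcx db).
  have z1 : 'D_((0, 0), 1) cy x = 0.
    rewrite (derive_mul_fun _ (differentiable_cst _ _)); last first.
      exact: C1at_differentiable (C1at_snd (C1at_fst (Cid x))).
    rewrite derive_cst (derive_snd _ (C1at_differentiable (C1at_fst (Cid x)))).
    rewrite (derive_fst _ (C1at_differentiable (Cid x))) derive_id /=.
    by rewrite !mulr0 addr0.
  have z2 : 'D_((0, 0), 1) cx x = 0.
    rewrite (derive_mul_fun _ (differentiable_cst _ _)); last first.
      exact: C1at_differentiable (C1at_fst (C1at_fst (Cid x))).
    rewrite derive_cst (derive_fst _ (C1at_differentiable (C1at_fst (Cid x)))).
    rewrite (derive_fst _ (C1at_differentiable (Cid x))) derive_id /=.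
    by rewrite !mulr0 addr0.
  by rewrite z1 z2 !mulr0 !addr0.
have := div_flow Ox; rewrite (derive_triple _ da) (derive_triple _ db) /=.
have := Dpsi _ Ox; rewrite (derive_triple _ dpsi) /= -/(m x) Dm => Dp Dd.
rewrite [LHS]mulrC -Dp; move: Dd.
move: (m x) (a x) (b x) (psi x) x.1.1 x.1.2 ('D_((1, 0), 0) psi x)
  ('D_((0, 1), 0) psi x) ('D_((0, 0), 1) psi x) ('D_((1, 0), 0) a x)
  ('D_((0, 1), 0) a x) ('D_((0, 0), 1) a x) ('D_((1, 0), 0) b x)
  ('D_((0, 1), 0) b x) ('D_((0, 0), 1) b x).
move=> {Dm Dp} M A B0 P y1 y2 p1 p2 p3 a1 a2 a3 b1 b2 b3 Dd.
(* Product rule [div (P V) = V P + P div V]; the factor after [P] is [div V], zero by [Dd]. *)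
transitivity (A * p1 + B0 * p2 + M * p3 + P *
  (1 * a1 + 0 * a2 + 2 * y2 * a3 + (0 * b1 + 1 * b2 + -2 * y1 * b3))).
  by rewrite Dd mulr0 addr0.
by ring.
Qed.

Local Notation cmod := ComplexField.Normc.normc.

Lemma cmodE (z : R[i]) : cmod z = Num.sqrt (complex.Re z ^+ 2 + complex.Im z ^+ 2).
Proof. by case: z. Qed.

Lemma flow_densityE s p : I s -> Lambda p ->
  let k := cmod (q (Phi (s, p))) in let m := cmod (curve_dz (leaf p) s) in
  [/\ 0 < k, 0 < m & h (Phi (s, p)) = k ^+ 2 / (Num.sqrt k * m)].
Proof.
move=> Is Lp k m; have Isp : (I `*` Lambda) (s, p) by [].
have [Ox gx] := PhiK Isp; have [r0 i0] := r_gt0 Ox; have N0 := N_gt0 Ox.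
have cE : c (Phi (s, p)) = (leaf_velocity (s, p)).1.1 by rewrite /c gx.
have dE : d (Phi (s, p)) = (leaf_velocity (s, p)).1.2 by rewrite /d gx.
have kE : k = Num.sqrt (N (Phi (s, p))) by rewrite /k cmodE.
have mE : m = Num.sqrt (c (Phi (s, p)) ^+ 2 + d (Phi (s, p)) ^+ 2).
  by rewrite /m (curve_dzE Is Lp) cE dE.
move: kE mE r0 i0 N0; rewrite /h /flow_density.
set x := Phi (s, p); move=> kE mE r0 i0 N0.
have k2 : k ^+ 2 = N x by rewrite kE sqr_sqrtr// ltW.
have k0 : 0 < k by rewrite kE sqrtr_gt0.
have n0 : 0 <= c x ^+ 2 + d x ^+ 2 by rewrite addr_ge0// sqr_ge0.
have m2 : m ^+ 2 = c x ^+ 2 + d x ^+ 2 by rewrite mE sqr_sqrtr.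
have m0 : 0 <= m by rewrite mE sqrtr_ge0.
have rE : r x = k * m ^+ 2.
  apply/eqP; rewrite -(@eqrXn2 _ 2)// ?(ltW r0)//; last by rewrite mulr_ge0 ?(ltW k0) ?sqr_ge0.
  apply/eqP; rewrite exprMn k2 m2.
  (* [r] and the expression that vanishes by [i0] are the two parts of [q (c + i d)^2], so their
     squares add up to [|q|^2 |c + i d|^4]. *)
  transitivity (r x ^+ 2 +
    (2 * (u x * (c x * d x)) + v x * (c x * c x - d x * d x)) ^+ 2).
    by rewrite i0 expr0n addr0.
  by rewrite /r /N; ring.
have mp : 0 < m.
  rewrite lt0r m0 andbT; apply/negP => /eqP m00.
  by move: r0; rewrite rE m00 expr0n mulr0 ltxx.
split => //; rewrite k2 rE sqrtrM ?(ltW k0)// sqrtr_sqr ger0_norm//.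
Qed.

Lemma continuous_leaf_velocity z : (I `*` Lambda) z -> {for z, continuous leaf_velocity}.
Proof. by move=> ILz; apply: C1at_continuous; exact: (C1at_derive_Ck2 _ oIL CPhi). Qed.

End foliation.

(** * Disintegration along the leaves *)

Section disintegration.
Context {R : realType}.
Local Notation mR := (measurableTypeR R).
Local Notation mu := (@lebesgue_measure R).
Local Notation H := (R * R * R)%type.
Local Notation X := (R * (R * R))%type.
Local Notation mH := (mR * mR * mR)%type.
Local Notation mX := (mR * (mR * mR))%type.
Local Notation mR2 := (mR * mR)%type.

Lemma continuous_restrict (V : topologicalType) (O K : set V) (f : V -> R) :
  open O -> closed K -> K `<=` O -> (forall x, O x -> {for x, continuous f}) ->
  (forall x, O x -> ~ K x -> f x = 0) -> continuous (f \_ O).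
Proof.
move=> oO cK KO cf f0 x; have [Ox|Ox] := pselect (O x).
  have E : \forall y \near x, f y = (f \_ O) y.
    apply: filterS (open_nbhs_nbhs (conj oO Ox)) => y Oy.
    by rewrite patchE mem_set.
  by rewrite /continuous_at -(nbhs_singleton E); exact: cvg_trans (near_eq_cvg E) (cf x Ox).
have E : \forall y \near x, cst 0 y = (f \_ O) y.
  have : nbhs x (~` K).
    by apply: open_nbhs_nbhs; split; [exact: closed_openC|move/KO].
  apply: filterS => y Ky; rewrite patchE; case: ifPn => // /set_mem Oy.
  by rewrite f0.
rewrite /continuous_at -(nbhs_singleton E).
exact: cvg_trans (near_eq_cvg E) (cvg_cst 0).
Qed.

Variables (Omega : set H) (I : set R) (Lambda : set (R * R)).
Variables (Phi : X -> H) (g : H -> X) (h : H -> R).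
Hypotheses (oOmega : open Omega) (oI : open I) (oLambda : open Lambda).
Hypothesis itvI : is_interval I.
Hypothesis cPhi : forall z, (I `*` Lambda) z -> {for z, continuous Phi}.
Hypothesis cg : forall x, Omega x -> {for x, continuous g}.
Hypothesis ch : forall x, Omega x -> {for x, continuous h}.
Hypothesis h_ge0 : forall x, Omega x -> 0 <= h x.
Hypothesis PhiK : forall z, (I `*` Lambda) z -> Omega (Phi z) /\ g (Phi z) = z.
Hypothesis gK : forall x, Omega x -> (I `*` Lambda) (g x) /\ Phi (g x) = x.
Hypothesis flow : forall (alpha beta gamma : R -> R) (j k c1 d1 c2 d2 : R),
  (forall t, derivable alpha t 1) -> continuous (derive1 alpha) ->
  (forall t, C1at beta t) -> (forall t, C1at gamma t) ->
  `[j, k] `*` (`[c1, d1] `*` `[c2, d2]) `<=` I `*` Lambda ->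
  (forall t, ~~ (j < t < k) -> alpha t = 0) ->
  (forall t, ~~ (c1 < t < d1) -> beta t = 0) ->
  (forall t, ~~ (c2 < t < d2) -> gamma t = 0) ->
  (\int[lebesgue3 R]_(x in (Omega : set mH))
     (derive1 alpha (g x).1 * (beta (g x).2.1 * gamma (g x).2.2) * h x)%:E = 0)%E.

Let mOmega : measurable (Omega : set mH).
Proof. exact: open_measurableH. Qed.

(** Outside [Omega] the map [G] takes a default value; the weight [w] is zero there, so this value
    contributes nothing. *)
Let G : mH -> mX := g \_ Omega.
Let w : mH -> R := h \_ Omega.

Let mG : measurable_fun setT G.
Proof.
apply/(measurable_restrictT _ mOmega).
have c1 x : Omega x -> {for x, continuous (fun y => (g y).1)}.
  by move=> Ox; exact: (continuous_comp (cg Ox) cvg_fst).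
have c2 x : Omega x -> {for x, continuous (fun y => (g y).2)}.
  by move=> Ox; exact: (continuous_comp (cg Ox) cvg_snd).
have c21 x : Omega x -> {for x, continuous (fun y => (g y).2.1)}.
  by move=> Ox; exact: (continuous_comp (c2 x Ox) cvg_fst).
have c22 x : Omega x -> {for x, continuous (fun y => (g y).2.2)}.
  by move=> Ox; exact: (continuous_comp (c2 x Ox) cvg_snd).
have m1 := continuous_measurableH oOmega c1.
have m21 := continuous_measurableH oOmega c21.
have m22 := continuous_measurableH oOmega c22.
have -> : (g : mH -> mX) = (fun x => ((g x).1, ((g x).2.1, (g x).2.2))).
  by apply/funext => x; case: (g x) => a [b c].
have m2 := @measurable_fun_pair_on _ _ _ mH mR mR Omega _ _ mOmega m21 m22.
exact: (@measurable_fun_pair_on _ _ _ mH mR mR2 Omega _ _ mOmega m1 m2).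
Qed.

Let mw : measurable_fun setT w.
Proof.
apply/(measurable_restrictT _ mOmega); exact: continuous_measurableH.
Qed.

Let w_ge0 x : 0 <= w x.
Proof. by rewrite /w patchE; case: ifPn => // /set_mem; exact: h_ge0. Qed.

(** The measure [h dL^3] on [Omega], transported to the leaf coordinates. *)
Let M := image_density (lebesgue3 R) mG mw w_ge0.

Local Notation cbox j k c d e f := (`[j, k] `*` (`[c, d] `*` `[e, f])).
Local Notation obox j k c d e f := (`]j, k[ `*` (`]c, d[ `*` `]e, f[)).

Let compact_image_box (j k c d e f : R) : cbox j k c d e f `<=` I `*` Lambda ->
  compact (Phi @` cbox j k c d e f) /\ Phi @` cbox j k c d e f `<=` Omega.
Proof.
move=> sub; split; last by move=> _ [z /sub Bz <-]; have [] := PhiK Bz.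
apply: continuous_compact.
  by apply: continuous_in_subspaceT => z /set_mem /sub; exact: cPhi.
by do 2 (apply: compact_setX; first exact: segment_compact); exact: segment_compact.
Qed.

Let integrable_box (F : X -> R) (j k c d e f : R) :
  cbox j k c d e f `<=` I `*` Lambda -> continuous F ->
  (forall z, ~ cbox j k c d e f z -> F z = 0) ->
  (lebesgue3 R).-integrable setT (EFin \o (fun x => F (G x) * w x)).
Proof.
move=> sub cF F0; have [cK KO] := compact_image_box sub.
have clK := compact_closed (@norm_hausdorff _ _) cK.
have [n n0 Kn] := compact_cube cK.
have -> : (fun x => F (G x) * w x) = (fun x => F (g x) * h x) \_ Omega.
  apply/funext => x; rewrite /G /w !patchE; case: ifPn => //.
  by rewrite mulr0.
have f0 x : Omega x -> ~ (Phi @` cbox j k c d e f) x -> F (g x) * h x = 0.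
  move=> Ox nK; rewrite F0 ?mul0r// => Bg; apply: nK; exists (g x) => //.
  by have [] := gK Ox.
apply: (@continuous_compact_support_integrable _ _ n).
  apply: continuous_restrict clK KO _ f0 => // x Ox.
  apply: cvgM; last exact: ch.
  exact: (continuous_comp (cg Ox) (cF _)).
move=> x nx; rewrite patchE; case: ifPn => // /set_mem Ox.
by apply: f0 => // /Kn.
Qed.

Let box_integral (F : X -> R) : continuous F -> (forall z, 0 <= F z) ->
  (\int[M]_z (F z)%:E = \int[lebesgue3 R]_x (F (G x) * w x)%:E)%E.
Proof.
move=> cF F0; rewrite integral_image_density//.
  by apply/measurable_EFinP; apply: (continuous_measurable3 openT) => z _; exact: cF.
Qed.

Variables (i0 i1 : R) (eta0 : R -> R).
Hypotheses (i01 : i0 < i1) (i01I : `[i0, i1] `<=` I).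
Hypotheses (ceta0 : continuous eta0) (eta0_ge0 : forall t, 0 <= eta0 t).
Hypothesis eta0_out : forall t, ~~ (i0 < t < i1) -> eta0 t = 0.
Hypothesis int_eta0 : (\int[mu]_t (eta0 t)%:E = 1)%E.

Let product_fun (eta beta gamma : R -> R) (z : X) := eta z.1 * (beta z.2.1 * gamma z.2.2).

Let continuous_product_fun eta beta gamma : continuous eta -> continuous beta ->
  continuous gamma -> continuous (product_fun eta beta gamma).
Proof.
move=> ceta cbeta cgamma z.
have c1 : x.1 @[x --> z] --> z.1 by exact: cvg_fst.
have c2 : x.2 @[x --> z] --> z.2 by exact: cvg_snd.
have c21 : x.2.1 @[x --> z] --> z.2.1 by exact: (continuous_comp c2 cvg_fst).
have c22 : x.2.2 @[x --> z] --> z.2.2 by exact: (continuous_comp c2 cvg_snd).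
have e1 := continuous_comp c1 (ceta z.1).
have e2 := continuous_comp c21 (cbeta z.2.1).
have e3 := continuous_comp c22 (cgamma z.2.2).
exact: (cvgM e1 (cvgM e2 e3)).
Qed.

Let product_fun_out eta beta gamma j k c d e f :
  (forall t, ~~ (j < t < k) -> eta t = 0) ->
  (forall t, ~~ (c < t < d) -> beta t = 0) ->
  (forall t, ~~ (e < t < f) -> gamma t = 0) ->
  forall z, ~ cbox j k c d e f z -> product_fun eta beta gamma z = 0.
Proof.
move=> eta_out beta_out gamma_out z nz; rewrite /product_fun.
apply/eqP; apply: contra_notT nz; rewrite !mulf_eq0 !negb_or => /and3P[a0 b0 c0].
split; [|split]; apply/subset_itv_oo_cc; rewrite /= in_itv/=.
- by apply: contraNT a0 => /eta_out ->.
- by apply: contraNT b0 => /beta_out ->.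
- by apply: contraNT c0 => /gamma_out ->.
Qed.

(* [eta] and [(\int eta) eta0] have the same integral, so that their difference
   is [derive1 alpha] for some [alpha] to which [flow] applies. *)
Lemma flow_scale (eta beta gamma : R -> R) (j k c d e f : R) :
  j < k -> c < d -> e < f -> cbox j k c d e f `<=` I `*` Lambda ->
  continuous eta -> (forall t, C1at beta t) -> (forall t, C1at gamma t) ->
  (forall t, ~~ (j < t < k) -> eta t = 0) ->
  (forall t, ~~ (c < t < d) -> beta t = 0) ->
  (forall t, ~~ (e < t < f) -> gamma t = 0) ->
  (\int[lebesgue3 R]_x (product_fun eta beta gamma (G x) * w x)%:E =
   \int[mu]_t (eta t)%:E *
   \int[lebesgue3 R]_x (product_fun eta0 beta gamma (G x) * w x)%:E)%E.
Proof.
move=> jk cd ef sub ceta Cbeta Cgamma eta_out beta_out gamma_out.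
have subI t : j <= t <= k -> I t.
  move=> jtk; have : cbox j k c d e f (t, (c, e)).
    by split; [|split]; rewrite /= in_itv//= lexx ltW.
  by move=> /sub[].
have subL p : (`[c, d] `*` `[e, f]) p -> Lambda p.
  move=> Lp; have : cbox j k c d e f (j, p) by split => //=; rewrite in_itv/= lexx ltW.
  by move=> /sub[].
(* A common interval for the supports of [eta] and [eta0]. Its end points lie in [I], hence so does
   all of it, [I] being an interval. *)
pose J := Num.min j i0; pose K := Num.max k i1.
have JI : I J.
  rewrite /J; case: leP => _; first by apply: subI; rewrite lexx ltW.
  by apply: i01I => /=; rewrite in_itv/= lexx ltW.
have KI : I K.
  rewrite /K; case: leP => _; last by apply: subI; rewrite lexx ltW.
  by apply: i01I => /=; rewrite in_itv/= lexx ltW.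
have JK : J < K by rewrite gt_min !lt_max jk.
have sub' : cbox J K c d e f `<=` I `*` Lambda.
  by move=> [t p] [/= tJK pL]; split; [exact: itvI JI KI _ tJK|exact: subL].
have ieta := integrable_continuous_support ceta eta_out.
have ieta0 := integrable_continuous_support ceta0 eta0_out.
pose C := fine (\int[mu]_t (eta t)%:E).
have CE : (\int[mu]_t (eta t)%:E = C%:E)%E.
  by rewrite fineK//; exact: integrable_fin_num ieta.
pose eta1 t := eta t - C * eta0 t.
have ceta1 : continuous eta1.
  by move=> t; apply: cvgB; [exact: ceta|apply: cvgM; [exact: cvg_cst|exact: ceta0]].
have out_eta t : ~~ (J < t < K) -> eta t = 0.
  move=> tJK; apply: eta_out; apply: contra tJK => /andP[jt tk].
  by rewrite gt_min jt lt_max tk.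
have out_eta0 t : ~~ (J < t < K) -> eta0 t = 0.
  move=> tJK; apply: eta0_out; apply: contra tJK => /andP[jt tk].
  by rewrite gt_min jt lt_max tk !orbT.
have out_eta1 t : ~~ (J < t < K) -> eta1 t = 0.
  by move=> tJK; rewrite /eta1 out_eta// out_eta0// mulr0 subr0.
have int_eta1 : (\int[mu]_t (eta1 t)%:E = 0)%E.
  have iC := integrableZl measurableT C ieta0.
  transitivity (\int[mu]_t ((eta t)%:E - C%:E * (eta0 t)%:E))%E.
    by apply: eq_integral => t _; rewrite /eta1 EFinB EFinM.
  rewrite (integralB measurableT ieta iC) (integralZl measurableT ieta0) int_eta0 CE.
  by rewrite mule1 subee.
have [alpha [dalpha alphaE out_alpha]] := ex_primitive JK ceta1 out_eta1 int_eta1.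
have cbeta : continuous beta by move=> t; exact: C1at_continuous.
have cgamma : continuous gamma by move=> t; exact: C1at_continuous.
have i1' := integrable_box sub' (continuous_product_fun ceta cbeta cgamma)
  (product_fun_out out_eta beta_out gamma_out).
have i2' := integrable_box sub' (continuous_product_fun ceta0 cbeta cgamma)
  (product_fun_out out_eta0 beta_out gamma_out).
have := @flow alpha beta gamma J K c d e f dalpha.
rewrite alphaE => /(_ ceta1 Cbeta Cgamma sub' out_alpha beta_out gamma_out).
set A := (\int[lebesgue3 R]_x (product_fun eta beta gamma (G x) * w x)%:E)%E.
set B := (\int[lebesgue3 R]_x (product_fun eta0 beta gamma (G x) * w x)%:E)%E.
have fA : A \is a fin_num by exact: integrable_fin_num i1'.
have fB : B \is a fin_num by exact: integrable_fin_num i2'.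
have -> : (\int[lebesgue3 R]_(x in (Omega : set mH))
     (eta1 (g x).1 * (beta (g x).2.1 * gamma (g x).2.2) * h x)%:E = A - C%:E * B)%E.
  rewrite integral_mkcond -(integralZl measurableT i2').
  rewrite -(integralB measurableT i1' (integrableZl measurableT C i2')).
  apply: eq_integral => x _; rewrite patchE /= /G /w !patchE.
  case: ifPn => _; first by rewrite -EFinD; congr (_%:E); rewrite /product_fun /eta1; ring.
  have p0 : point = 0 :> R by [].
  by rewrite p0 !mulr0 oppr0 -EFinD addr0.
by rewrite CE -(fineK fA) -(fineK fB) -!EFinM -EFinB => -[/subr0_eq ->].
Qed.

Let G2 (x : mH) : mR2 := (G x).2.

Let mG2 : measurable_fun setT G2.
Proof. exact: (measurableT_comp measurable_snd mG). Qed.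

Let w2 (x : mH) : R := eta0 (G x).1 * w x.

Let mw2 : measurable_fun setT w2.
Proof.
apply: measurable_funM => //.
have m1 := measurableT_comp measurable_fst mG.
exact: (measurableT_comp (continuous_measurable_fun ceta0) m1).
Qed.

Let w2_ge0 x : 0 <= w2 x.
Proof. by rewrite mulr_ge0. Qed.

(** If [M] is to be the product of Lebesgue measure and [nu], integrating [eta0 (s) f (p)] against
    [M] must give the [nu]-integral of [f], as [eta0] has integral 1. This dictates the density
    [w2]. *)
Let nu := image_density (lebesgue3 R) mG2 mw2 w2_ge0.

Let nu_bump c d e f n : (\int[nu]_p (c1bump c d n p.1 * c1bump e f n p.2)%:E =
  \int[lebesgue3 R]_x (product_fun eta0 (c1bump c d n) (c1bump e f n) (G x) * w x)%:E)%E.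
Proof.
rewrite integral_image_density; last 2 first.
- apply/measurable_EFinP; apply: measurable_funM.
    exact: (measurableT_comp (measurable_bump c d n) measurable_fst).
  exact: (measurableT_comp (measurable_bump e f n) measurable_snd).
- by move=> p; rewrite lee_fin mulr_ge0// bump_ge0.
by apply: eq_integral => x _; rewrite -EFinM /w2 /product_fun /G2; congr (_%:E); ring.
Qed.

Let nu_bump_cvg c d e f : c < d -> e < f ->
  (\int[nu]_p (c1bump c d n p.1 * c1bump e f n p.2)%:E @[n --> \oo] -->
    nu (`]c, d[ `*` `]e, f[))%E.
Proof.
move=> cd ef.
have mr : measurable (`]c, d[ `*` `]e, f[ : set mR2).
  by apply: measurableX; exact: measurable_itv.
have <- : (\int[nu]_p (\1_(`]c, d[ `*` `]e, f[) p : R)%:E = nu (`]c, d[ `*` `]e, f[))%E.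
  by rewrite integral_indic// setIT.
have cv (p : mR2) : (c1bump c d n p.1 * c1bump e f n p.2)%:E @[n --> \oo] -->
    (\1_(`]c, d[ `*` `]e, f[) p : R)%:E.
  apply: cvg_EFin; first exact: nearW.
  have -> : \1_(`]c, d[ `*` `]e, f[) p =
      \1_(`]c, d[%classic) p.1 * \1_(`]e, f[%classic) p.2 :> R.
    by rewrite !indicE in_setX -natrM mulnb.
  by apply: cvgM; exact: bump_cvg.
rewrite (_ : (fun p => _) =
    (fun p : mR2 => limn (fun n => (c1bump c d n p.1 * c1bump e f n p.2)%:E))); last first.
  by apply/funext => p; apply/esym/cvg_lim => //; exact: cv.
apply: cvg_monotone_convergence => //.
- move=> n; apply/measurable_EFinP; apply: measurable_funM.
    exact: (measurableT_comp (measurable_bump c d n) measurable_fst).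
  exact: (measurableT_comp (measurable_bump e f n) measurable_snd).
- by move=> n p _; rewrite lee_fin mulr_ge0// bump_ge0.
- by move=> p _ m n mn; rewrite lee_fin ler_pM ?bump_ge0// bump_nd.
Qed.

Let M_bump_cvg j k c d e f : j < k -> c < d -> e < f ->
  (\int[lebesgue3 R]_x
     (product_fun (c1bump j k n) (c1bump c d n) (c1bump e f n) (G x) * w x)%:E @[n --> \oo] -->
    M (obox j k c d e f))%E.
Proof.
move=> jk cd ef.
have mr : measurable (obox j k c d e f : set mX).
  by do 2 (apply: measurableX; [exact: measurable_itv|]); exact: measurable_itv.
have cb n (a b : R) := @continuous_bump R a b n.
have pf0 n z : 0 <= product_fun (c1bump j k n) (c1bump c d n) (c1bump e f n) z.
  by rewrite /product_fun !mulr_ge0// bump_ge0.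
have cpf n := continuous_product_fun (cb n j k) (cb n c d) (cb n e f).
under eq_fun do rewrite -box_integral//.
have <- : (\int[M]_z (\1_(obox j k c d e f) z : R)%:E = M (obox j k c d e f))%E.
  by rewrite integral_indic// setIT.
have cv (z : mX) : (product_fun (c1bump j k n) (c1bump c d n) (c1bump e f n) z)%:E @[n --> \oo] -->
    (\1_(obox j k c d e f) z : R)%:E.
  apply: cvg_EFin; first exact: nearW.
  have -> : \1_(obox j k c d e f) z = \1_(`]j, k[%classic) z.1 *
      (\1_(`]c, d[%classic) z.2.1 * \1_(`]e, f[%classic) z.2.2) :> R.
    by rewrite !indicE !in_setX -!natrM !mulnb.
  by apply: cvgM; [|apply: cvgM]; exact: bump_cvg.
rewrite (_ : (fun z => _) = (fun z : mX => limn (fun n =>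
    (product_fun (c1bump j k n) (c1bump c d n) (c1bump e f n) z)%:E))); last first.
  by apply/funext => z; apply/esym/cvg_lim => //; exact: cv.
apply: cvg_monotone_convergence => //.
- move=> n; apply/measurable_EFinP.
  by apply: (continuous_measurable3 openT) => z _; exact: cpf.
- by move=> n z _; rewrite lee_fin.
- move=> z _ m n mn; rewrite lee_fin /product_fun.
  by rewrite !ler_pM ?mulr_ge0 ?bump_ge0// bump_nd.
Qed.

(** The limit of [flow_scale] for bumps increasing to the indicators of the three intervals. *)
Let M_obox j k c d e f : j < k -> c < d -> e < f ->
  cbox j k c d e f `<=` I `*` Lambda ->
  M (obox j k c d e f) = ((k - j)%:E * nu (`]c, d[ `*` `]e, f[))%E.
Proof.
move=> jk cd ef sub.
have cv := M_bump_cvg jk cd ef.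
apply: (cvg_unique (@ereal_hausdorff R) cv).
rewrite (_ : (fun n => _) = (fun n => \int[mu]_t (c1bump j k n t)%:E *
    \int[nu]_p (c1bump c d n p.1 * c1bump e f n p.2)%:E)%E); last first.
  apply/funext => n; rewrite nu_bump.
  apply: flow_scale sub _ _ _ _ _ _ => //.
  - exact: continuous_bump.
  - exact: C1at_bump.
  - exact: C1at_bump.
  - by move=> t; exact: bump_out.
  - by move=> t; exact: bump_out.
  - by move=> t; exact: bump_out.
apply: cvgeM; [|exact: integral_bump_cvg|exact: nu_bump_cvg].
(* The limit of the product could only fail at zero times infinity, which [j < k] excludes. *)
have [nf|nf] := boolP (nu (`]c, d[ `*` `]e, f[) \is a fin_num).
  by rewrite mule_def_fin.
by rewrite mule_def_neq0_infty// eqe subr_eq0 gt_eqF.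
Qed.

(** The mass of the box is the integral of [h] over its image under [Phi], a compact subset of
    [Omega] on which [h] is bounded. *)
Let M_cbox_fin j k c d e f : cbox j k c d e f `<=` I `*` Lambda ->
  (M (cbox j k c d e f) < +oo)%E.
Proof.
move=> sub; have [cK KO] := compact_image_box sub.
set K := Phi @` _ in cK KO.
have clK := compact_closed (@norm_hausdorff _ _) cK.
have mK : measurable (K : set mH).
  rewrite -[K]setCK; apply: measurableC; apply: open_measurableH.
  exact: closed_openC.
have [n n0 Kn] := compact_cube cK.
have finK : (lebesgue3 R K < +oo)%E.
  apply: le_lt_trans (lebesgue3_cube_fin n); apply: le_measure => //; rewrite inE//.
  by do 2 (apply: measurableX; last exact: measurable_itv); exact: measurable_itv.
have [B [_ hB]] : bounded_set (h @` K).
  apply: compact_bounded; apply: continuous_compact => //.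
  by apply: continuous_in_subspaceT => x /set_mem /KO; exact: ch.
have iw : (lebesgue3 R).-integrable setT (EFin \o (w \_ K)).
  apply: (@bounded_support_integrable R _ mH (lebesgue3 R) K (w \_ K) (Num.max 0 (B + 1))) => //.
  - by apply/(measurable_restrictT _ mK); exact: measurable_funS mw.
  - move=> x; rewrite patchE; case: ifPn => [/set_mem Kx|_]; last first.
      by rewrite normr0 le_max lexx.
    rewrite le_max; apply/orP; right; apply: hB; first by rewrite ltrDl.
    by exists x => //; rewrite /w patchE mem_set//; exact: KO.
  - by move=> x nK; rewrite patchE memNset.
rewrite (_ : M _ = \int[lebesgue3 R]_x (EFin \o (w \_ K)) x)%E.
  by have := integrable_fin_num measurableT iw; rewrite fin_numElt => /andP[].
rewrite [LHS]integral_mkcond; apply: eq_integral => x _; rewrite /= !patchE.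
case: ifPn => [/set_mem BG|/negP nBG]; case: ifPn => [/set_mem Kx|/negP nKx] //.
- have [Ox|nOx] := pselect (Omega x); last by rewrite /w patchE memNset.
  exfalso; apply: nKx; rewrite inE; move: BG; rewrite /= /G patchE mem_set// => BG.
  by exists (g x) => //; have [] := gK Ox.
- exfalso; apply: nBG; rewrite inE /= /G patchE mem_set; last exact: KO.
  by have [z Bz <-] := Kx; have [_ ->] := PhiK (sub _ Bz).
Qed.

(** With [K] a bound of [eta0], whose support lies between [i0] and [i1], the mass of the rectangle
    is at most [K] times the [M]-mass of the closed box over it. *)
Let nu_rect_fin c d e f : cbox i0 i1 c d e f `<=` I `*` Lambda ->
  (nu (`]c, d[ `*` `]e, f[) < +oo)%E.
Proof.
move=> sub; have Mfin := M_cbox_fin sub.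
have [B [_ hB]] : bounded_set (eta0 @` `[i0, i1]).
  apply: compact_bounded; apply: continuous_compact; last exact: segment_compact.
  exact: continuous_subspaceT.
pose K := Num.max 0 (B + 1).
have etaK t : eta0 t <= K.
  have [t01|t01] := boolP (i0 < t < i1); last by rewrite eta0_out// le_max lexx.
  rewrite le_max; apply/orP; right; apply: le_trans (ler_norm _) _.
  apply: hB; first by rewrite ltrDl.
  by exists t => //=; apply: subset_itv_oo_cc; rewrite /= in_itv.
have mB : measurable (cbox i0 i1 c d e f : set mX).
  by do 2 (apply: measurableX; [exact: measurable_itv|]); exact: measurable_itv.
have mGB : measurable (G @^-1` cbox i0 i1 c d e f).
  by rewrite -[_ @^-1` _]setTI; exact: mG.
have mr : measurable (`]c, d[ `*` `]e, f[ : set mR2).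
  by apply: measurableX; exact: measurable_itv.
have mGr : measurable (G2 @^-1` (`]c, d[ `*` `]e, f[)).
  by rewrite -[_ @^-1` _]setTI; exact: mG2.
apply: (@le_lt_trans _ _ (K%:E * M (cbox i0 i1 c d e f))%E); last first.
  by rewrite lte_mul_pinfty// lee_fin le_max lexx.
rewrite -ge0_integralZl//; last 3 first.
- by apply/measurable_EFinP; exact: measurable_funS mw.
- by move=> x _; rewrite lee_fin.
- by rewrite lee_fin le_max lexx.
rewrite [leLHS]integral_mkcond [leRHS]integral_mkcond; apply: ge0_le_integral => //.
- by move=> x _; rewrite patchE; case: ifPn => //; rewrite lee_fin.
- by apply/(measurable_restrictT _ mGr)/measurable_EFinP; exact: measurable_funS mw2.
- apply/(measurable_restrictT _ mGB); apply: emeasurable_funM => //.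
  by apply/measurable_EFinP; exact: measurable_funS mw.
- move=> x _; rewrite !patchE; case: ifPn => [/set_mem r|_]; last first.
    case: ifPn => // _; rewrite mule_ge0// lee_fin// le_max lexx//.
  have [t01|t01] := boolP (i0 < (G x).1 < i1); last first.
    rewrite /w2 eta0_out// mul0r; case: ifPn => // _.
    by rewrite mule_ge0// lee_fin// le_max lexx.
  rewrite mem_set; first by rewrite -EFinM lee_fin ler_wpM2r.
  case: r => /= r1 r2.
  by split; [|split] => /=; apply/subset_itv_oo_cc => //; rewrite /= in_itv.
Qed.

Let nu_sigma_finite : sigma_finite setT nu.
Proof.
have [j [k [c [d [e [f [sub cov]]]]]]] := open_box_cover (open_setX oI oLambda).
have mrect n : measurable (`]c n, d n[ `*` `]e n, f n[ : set mR2).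
  by apply: measurableX; exact: measurable_itv.
have mL : measurable (~` Lambda : set mR2).
  by apply: measurableC; exact: open_measurable2.
have i0I : I i0 by apply: i01I; rewrite /= in_itv/= lexx ltW.
(* Only boxes that cross the slice [s = i0] are kept: their rectangles cover [Lambda]. The
   complement of [Lambda] is null, because a point that [G2] sends there lies outside [Omega], where
   [w] vanishes. *)
exists (fun n => (if j n < i0 < k n then `]c n, d n[ `*` `]e n, f n[ else set0) `|` ~` Lambda).
  apply/seteqP; split => // p _; have [Lp|nLp] := pselect (Lambda p); last first.
    by exists 0%N => //; right.
  have [n _ [/= i0n pn]] : (\bigcup_n (`]j n, k n[ `*` (`]c n, d n[ `*` `]e n, f n[))) (i0, p).
    by apply: cov.
  by exists n => //; left; move: i0n; rewrite in_itv/= => ->.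
move=> n; have mF : measurable (if j n < i0 < k n then
    (`]c n, d n[ `*` `]e n, f n[ : set mR2) else set0) by case: ifPn.
split; first exact: measurableU.
apply: le_lt_trans (measureU2 _ mF mL) _.
rewrite [X in (_ + X)%E](_ : _ = 0%E) ?adde0; last first.
  apply: integral0_eq => x /=; rewrite /G2 /G /w2 /w !patchE.
  case: ifPn => [/set_mem Ox|_]; last by rewrite mulr0.
  by have [[]] := gK Ox.
case: ifPn => [i0n|_]; last by rewrite measure0.
apply: nu_rect_fin => -[t p] [/= t01 pn]; split; first exact: i01I.
have : cbox (j n) (k n) (c n) (d n) (e n) (f n) (i0, p).
  by split => //=; apply/subset_itv_oo_cc; rewrite /= in_itv.
by move/(sub n) => [].
Qed.

Let nu_sfin : set mR2 -> \bar R := nu.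
HB.instance Definition _ := Measure.on nu_sfin.
HB.instance Definition _ := Measure_isSigmaFinite.Build _ _ _ nu_sfin nu_sigma_finite.
Let snu : {sigma_finite_measure set mR2 -> \bar R} := nu_sfin.

(** Both measures give an open box with closure in [I x Lambda] the same mass, by [M_obox]; a
    countable cover by such boxes extends this to all measurable subsets of [I x Lambda]. *)
Let M_prod (A : set mX) : measurable A -> A `<=` I `*` Lambda ->
  M A = prod_measure mu snu A.
Proof.
move=> mA AIL.
have [j [k [c [d [e [f [sub cov]]]]]]] := open_box_cover (open_setX oI oLambda).
have mbox (n : nat) : measurable (obox (j n) (k n) (c n) (d n) (e n) (f n) : set mX).
  by do 2 (apply: measurableX; [exact: measurable_itv|]); exact: measurable_itv.
apply: (measure_unique_cover mbox _ mA); last exact: subset_trans AIL cov.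
move=> n B mB; apply: measure_unique_box => //.
  apply: le_lt_trans (M_cbox_fin (sub n)); apply: le_measure; rewrite ?inE//.
    by do 2 (apply: measurableX; [exact: measurable_itv|]); exact: measurable_itv.
  by move=> z [z1 [z2 z3]]; split; [|split]; exact: subset_itv_oo_cc.
move=> j' k' c' d' e' f' jj kk cc dd ee ff.
have itv0 (x y : R) : y <= x -> `]x, y[%classic = set0.
  by move=> yx; apply: set_itv_ge; rewrite bnd_simp -leNgt.
(* Here and in the next two lines, an empty side makes both measures of the box zero. *)
have [jk|kj] := ltP j' k'; last by rewrite (itv0 _ _ kj) set0X !measure0.
have [cd|dc] := ltP c' d'; last by rewrite (itv0 _ _ dc) set0X setX0 !measure0.
have [ef|fe] := ltP e' f'; last by rewrite (itv0 _ _ fe) !setX0 !measure0.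
have sub' : cbox j' k' c' d' e' f' `<=` I `*` Lambda.
  move=> [x [y t]] [/= + [/= ]]; rewrite !in_itv/=.
  move=> /andP[x1 x2] /andP[y1 y2] /andP[t1 t2]; apply: (sub n (x, (y, t))).
  split; [|split]; rewrite /= in_itv/=.
  - by rewrite (le_trans jj x1) (le_trans x2 kk).
  - by rewrite (le_trans cc y1) (le_trans y2 dd).
  - by rewrite (le_trans ee t1) (le_trans t2 ff).
apply: etrans (M_obox jk cd ef sub') _.
apply/esym; apply: etrans (prod_measureE _ _ _ _) _; first exact: measurable_itv.
  by apply: measurableX; exact: measurable_itv.
congr (_ * _)%E; apply: etrans (lebesgue_measure_itv `]j', k'[) _.
by rewrite /= lte_fin jk.
Qed.

(** The two measures are compared inside [I x Lambda] only; the product with Lebesgue measure may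
    charge points with [t] outside [I], whence the condition that [F] vanish there. *)
Lemma disintegration_unit : exists nu : {sigma_finite_measure set mR2 -> \bar R},
  forall F : mX -> \bar R, measurable_fun setT F -> (forall z, 0 <= F z)%E ->
    (forall z, ~ (I `*` Lambda) z -> F z = 0%E) ->
  (\int[lebesgue3 R]_(x in (Omega : set mH)) (F (g x) * (h x)%:E) =
   \int[nu]_p \int[mu]_t F (t, p))%E.
Proof.
exists snu => F mF F0 F_out.
have mIL : measurable (I `*` Lambda : set mX).
  by apply: open_measurable3; exact: open_setX.
transitivity (\int[M]_z F z)%E.
  rewrite integral_image_density// [LHS]integral_mkcond; apply: eq_integral => x _.
  rewrite /G /w !patchE; case: ifPn => // _.
  by rewrite mule0.
have Frestr : F = F \_ (I `*` Lambda).
  apply/funext => z; rewrite patchE; case: ifPn => // /negP nz.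
  by apply: F_out => ILz; apply: nz; rewrite inE.
transitivity (\int[prod_measure mu snu]_z F z)%E; last first.
  exact: (@fubini_tonelli2 _ _ mR mR2 R mu snu F mF F0).
rewrite Frestr -!integral_mkcond; apply: eq_measure_integral => A mA AIL.
exact: M_prod.
Qed.

End disintegration.

(** Any unit bump supported in [I] can serve as [eta0], and one exists near every point of [I]. *)
Lemma disintegration (R : realType) (Omega : set (R * R * R)) (I : set R)
    (Lambda : set (R * R)) (Phi : R * (R * R) -> R * R * R)
    (g : R * R * R -> R * (R * R)) (h : R * R * R -> R) :
  open Omega -> open I -> open Lambda -> is_interval I -> I !=set0 ->
  (forall z, (I `*` Lambda) z -> {for z, continuous Phi}) ->
  (forall x, Omega x -> {for x, continuous g}) ->
  (forall x, Omega x -> {for x, continuous h}) ->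
  (forall x, Omega x -> 0 <= h x) ->
  (forall z, (I `*` Lambda) z -> Omega (Phi z) /\ g (Phi z) = z) ->
  (forall x, Omega x -> (I `*` Lambda) (g x) /\ Phi (g x) = x) ->
  (forall (alpha beta gamma : R -> R) (j k c1 d1 c2 d2 : R),
    (forall t, derivable alpha t 1) -> continuous (derive1 alpha) ->
    (forall t, C1at beta t) -> (forall t, C1at gamma t) ->
    `[j, k] `*` (`[c1, d1] `*` `[c2, d2]) `<=` I `*` Lambda ->
    (forall t, ~~ (j < t < k) -> alpha t = 0) ->
    (forall t, ~~ (c1 < t < d1) -> beta t = 0) ->
    (forall t, ~~ (c2 < t < d2) -> gamma t = 0) ->
    (\int[lebesgue3 R]_(x in Omega)
      (derive1 alpha (g x).1 * (beta (g x).2.1 * gamma (g x).2.2) * h x)%:E = 0)%E) ->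
  exists nu : {sigma_finite_measure set (measurableTypeR R * measurableTypeR R)%type -> \bar R},
  forall F : measurableTypeR R * (measurableTypeR R * measurableTypeR R) -> \bar R,
    measurable_fun setT F -> (forall z, 0 <= F z)%E ->
    (forall z, ~ (I `*` Lambda) z -> F z = 0%E) ->
  (\int[lebesgue3 R]_(x in Omega) (F (g x) * (h x)%:E) =
   \int[nu]_p \int[lebesgue_measure]_t F (t, p))%E.
Proof.
move=> oOmega oI oLambda itvI [s Is] cPhi cg ch h_ge0 PhiK gK flow.
have [[a b] /= [/andP[as_ sb] abI]] := nbhs_rat_itv (open_nbhs_nbhs (conj oI Is)).
have [eta [ceta eta0 eta_out int_eta]] := ex_unit_bump (lt_trans as_ sb).
exact: (disintegration_unit oOmega oI oLambda itvI cPhi cg ch h_ge0 PhiK gK flow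
  (lt_trans as_ sb) abI ceta eta0 eta_out int_eta).
Qed.

(** * The modulus *)

Section modulus.
Context {R : realType}.
Local Notation mR := (measurableTypeR R).
Local Notation mu := (@lebesgue_measure R).
Local Notation H := (R * R * R)%type.
Local Notation X := (R * (R * R))%type.
Local Notation mH := (mR * mR * mR)%type.
Local Notation mX := (mR * (mR * mR))%type.
Local Notation mR2 := (mR * mR)%type.
Local Notation cmod := ComplexField.Normc.normc.

Lemma continuous_normc (T : topologicalType) (f : T -> R[i]) x :
  {for x, continuous (fun y => complex.Re (f y))} ->
  {for x, continuous (fun y => complex.Im (f y))} ->
  {for x, continuous (fun y => cmod (f y))}.
Proof.
move=> cu cv.
have -> : (fun y => cmod (f y)) =
    (fun y => Num.sqrt (complex.Re (f y) * complex.Re (f y) + complex.Im (f y) * complex.Im (f y))).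
  by apply/funext => y; rewrite cmodE !expr2.
have c2 : {for x, continuous (fun y => complex.Re (f y) * complex.Re (f y) +
    complex.Im (f y) * complex.Im (f y))}.
  by apply: cvgD; apply: cvgM.
exact: (continuous_comp c2 (@sqrt_continuous R _)).
Qed.

(* Tangent line of [x^4] at [x = 1/C], for [x = rho / sqrt k]. *)
Lemma fourth_power_tangent (C k m : R) (rho : \bar R) : 0 < C -> 0 < k -> 0 < m ->
  (0 <= rho)%E ->
  ((4 / C ^+ 3)%:E * (rho * m%:E) <=
   rho ^+ 4 * (Num.sqrt k * m / k ^+ 2)%:E + (3 / C ^+ 4 * (Num.sqrt k * m))%:E)%E.
Proof.
move=> C0 k0 m0; have s0 : 0 < Num.sqrt k by rewrite sqrtr_gt0.
have kE : k = Num.sqrt k ^+ 2 by rewrite sqr_sqrtr// ltW.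
case: rho => [x| |]// x0; last first.
  rewrite (_ : (+oo ^+ 4 = +oo)%E); last by rewrite expeS gt0_mulye// expe_gt0.
  rewrite [X in (_ <= X + _)%E]gt0_mulye ?addye ?leey// lte_fin.
  by rewrite divr_gt0 ?mulr_gt0// exprn_gt0.
rewrite -EFin_expe -!EFinM -EFinD lee_fin.
move: x0; rewrite lee_fin => x0.
set s := Num.sqrt k in s0 kE *; rewrite kE.
have -> : x ^+ 4 * (s * m / (s ^+ 2) ^+ 2) = s * m * (x / s) ^+ 4.
  by field; rewrite gt_eqF.
have -> : 4 / C ^+ 3 * (x * m) = s * m * (4 / C ^+ 3 * (x / s)).
  by field; rewrite !gt_eqF.
have -> : 3 / C ^+ 4 * (s * m) = s * m * (3 / C ^+ 4) by ring.
rewrite -mulrDr ler_pM2l ?mulr_gt0//.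
set y := x / s.
rewrite -(ler_pM2l (exprn_gt0 4 C0)).
have -> : C ^+ 4 * (4 / C ^+ 3 * y) = 4 * (C * y) by field; rewrite gt_eqF.
have -> : C ^+ 4 * (y ^+ 4 + 3 / C ^+ 4) = (C * y) ^+ 4 + 3 by field; rewrite gt_eqF.
set z := C * y; rewrite -subr_ge0.
(* The double root [z = 1] is the point of contact, [rho = sqrt k / C]. *)
have -> : z ^+ 4 + 3 - 4 * z = (z - 1) ^+ 2 * ((z + 1) ^+ 2 + 2) by ring.
by rewrite mulr_ge0 ?sqr_ge0// addr_ge0 ?sqr_ge0.
Qed.

(** Integrating [fourth_power_tangent] over the leaf gives [4 / C^3] times the integral of [rho m]
    at most the wanted integral plus [(3 / C^4) C]. As the integral of [rho m] is at least 1, what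
    remains is [4 / C^3 - 3 / C^3]. *)
Lemma leaf_inequality (I : set R) (C : R) (k m : R -> R) (rho : R -> \bar R) :
  measurable I -> 0 < C ->
  measurable_fun I m -> measurable_fun I rho ->
  measurable_fun I (fun t => Num.sqrt (k t) * m t) ->
  measurable_fun I (fun t => Num.sqrt (k t) * m t / k t ^+ 2) ->
  (forall t, I t -> [/\ 0 < k t, 0 < m t & (0 <= rho t)%E]) ->
  (\int[mu]_(t in I) (Num.sqrt (k t) * m t)%:E = C%:E)%E ->
  (1 <= \int[mu]_(t in I) (rho t * (m t)%:E))%E ->
  ((C ^- 3)%:E <= \int[mu]_(t in I) (rho t ^+ 4 * (Num.sqrt (k t) * m t / k t ^+ 2)%:E))%E.
Proof.
move=> mI C0 mm mrho msm mtau pos intC int1.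
have mrm : measurable_fun I (fun t => rho t * (m t)%:E)%E.
  by apply: emeasurable_funM => //; exact/measurable_EFinP.
have mr4 : measurable_fun I (fun t => rho t ^+ 4 * (Num.sqrt (k t) * m t / k t ^+ 2)%:E)%E.
  apply: emeasurable_funM; last exact/measurable_EFinP.
  have m2 : measurable_fun I (fun t => rho t * rho t)%E by exact: emeasurable_funM.
  apply: (eq_measurable_fun (fun t => (rho t * rho t) * (rho t * rho t))%E).
    by move=> t _; rewrite !expeS expe0 mule1 !muleA.
  exact: emeasurable_funM.
have C3 : 0 < C ^+ 3 by rewrite exprn_gt0.
have C4 : 0 < C ^+ 4 by rewrite exprn_gt0.
have r4_ge0 t : I t -> (0 <= rho t ^+ 4 * (Num.sqrt (k t) * m t / k t ^+ 2)%:E)%E.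
  move=> It; have [k0 m0 r0] := pos t It.
  by rewrite mule_ge0 ?expe_ge0// lee_fin mulr_ge0 ?mulr_ge0 ?sqrtr_ge0 ?invr_ge0 ?sqr_ge0// ltW.
have : ((4 / C ^+ 3)%:E * \int[mu]_(t in I) (rho t * (m t)%:E) <=
  \int[mu]_(t in I) (rho t ^+ 4 * (Num.sqrt (k t) * m t / k t ^+ 2)%:E) + (3 / C ^+ 3)%:E)%E.
  have -> : (3 / C ^+ 3)%:E = ((3 / C ^+ 4)%:E * \int[mu]_(t in I) (Num.sqrt (k t) * m t)%:E)%E.
    by rewrite intC -EFinM; congr (_%:E); field; rewrite gt_eqF.
  rewrite -!ge0_integralZl//; last 5 first.
  - exact/measurable_EFinP.
  - by move=> t It; have [k0 m0 _] := pos t It; rewrite lee_fin mulr_ge0 ?sqrtr_ge0// ltW.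
  - by rewrite lee_fin divr_ge0// ltW.
  - by move=> t It; have [k0 m0 r0] := pos t It; rewrite mule_ge0// lee_fin ltW.
  - by rewrite lee_fin divr_ge0// ltW.
  rewrite -ge0_integralD//; last 2 first.
  - by move=> t It; have [k0 m0 _] := pos t It;
      rewrite -EFinM lee_fin !mulr_ge0 ?sqrtr_ge0 ?invr_ge0 ?ltW.
  - by apply: emeasurable_funM => //; exact/measurable_EFinP.
  apply: ge0_le_integral => //.
  - by move=> t It; have [k0 m0 r0] := pos t It;
      rewrite !mule_ge0// lee_fin ?divr_ge0 ?ltW.
  - exact: emeasurable_funM.
  - apply: emeasurable_funD => //; apply: emeasurable_funM => //.
    exact/measurable_EFinP.
  - move=> t It; have [k0 m0 r0] := pos t It.
    by rewrite -EFinM; exact: fourth_power_tangent.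
set A := (\int[mu]_(t in I) (rho t ^+ 4 * _))%E => hA.
have {}hA : ((4 / C ^+ 3)%:E <= A + (3 / C ^+ 3)%:E)%E.
  apply: le_trans hA; rewrite -[leLHS]mule1.
  by apply: lee_wpmul2l => //; rewrite lee_fin divr_ge0// ltW.
rewrite (_ : C ^- 3 = 4 / C ^+ 3 - 3 / C ^+ 3); last by field; rewrite gt_eqF.
by rewrite EFinB leeBlDr.
Qed.

Lemma continuous_measurable_mapH (D : set X) (f : X -> H) : open D ->
  (forall z, D z -> {for z, continuous f}) ->
  measurable_fun (D : set mX) (f : mX -> mH).
Proof.
move=> oD cf.
have mD : measurable (D : set mX) by exact: open_measurable3.
have c1 z : D z -> {for z, continuous (fun z => (f z).1)}.
  by move=> Dz; apply: (continuous_comp (cf z Dz)); exact: cvg_fst.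
have c11 z : D z -> {for z, continuous (fun z => (f z).1.1)}.
  by move=> Dz; apply: (continuous_comp (c1 z Dz)); exact: cvg_fst.
have c12 z : D z -> {for z, continuous (fun z => (f z).1.2)}.
  by move=> Dz; apply: (continuous_comp (c1 z Dz)); exact: cvg_snd.
have c2 z : D z -> {for z, continuous (fun z => (f z).2)}.
  by move=> Dz; apply: (continuous_comp (cf z Dz)); exact: cvg_snd.
have := measurable_fun_pair_on mD (measurable_fun_pair_on mD
  (continuous_measurable3 oD c11) (continuous_measurable3 oD c12)) (continuous_measurable3 oD c2).
by apply: eq_measurable_fun => z _; case: (f z) => [[]].
Qed.

(** Both integrals over [Omega] are disintegrated and compared leaf by leaf: on a leaf the volume
    contributes its length [C], so the claim there is [C^-4 C = C^-3] against the bound of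
    [leaf_inequality]. *)
Lemma volume_le_integral_fourth (Omega : set H) (I : set R) (Lambda : set (R * R))
    (Phi : X -> H) (g : H -> X) (k h : H -> R) (m : X -> R) (C : R)
    (nu : {sigma_finite_measure set mR2 -> \bar R}) (rho : H -> \bar R) :
  open I -> open Lambda -> open Omega ->
  (forall z, (I `*` Lambda) z -> {for z, continuous Phi}) ->
  (forall x, Omega x -> {for x, continuous k}) ->
  (forall z, (I `*` Lambda) z -> {for z, continuous m}) ->
  (forall z, (I `*` Lambda) z -> Omega (Phi z)) ->
  (forall x, Omega x -> (I `*` Lambda) (g x) /\ Phi (g x) = x) ->
  (forall z, (I `*` Lambda) z -> [/\ 0 < k (Phi z), 0 < m z &
    h (Phi z) = k (Phi z) ^+ 2 / (Num.sqrt (k (Phi z)) * m z)]) ->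
  (forall F : mX -> \bar R, measurable_fun setT F -> (forall z, 0 <= F z)%E ->
    (forall z, ~ (I `*` Lambda) z -> F z = 0%E) ->
    (\int[lebesgue3 R]_(x in Omega) (F (g x) * (h x)%:E) =
     \int[nu]_p \int[mu]_t F (t, p))%E) ->
  0 < C ->
  (forall p, Lambda p ->
    (\int[mu]_(t in I) (Num.sqrt (k (Phi (t, p))) * m (t, p))%:E = C%:E)%E) ->
  measurable_fun (Omega : set mH) (rho : mH -> \bar R) ->
  (forall x, Omega x -> (0 <= rho x)%E) ->
  (forall p, Lambda p -> (1 <= \int[mu]_(t in I) (rho (Phi (t, p)) * (m (t, p))%:E))%E) ->
  ((C ^- 4)%:E * \int[lebesgue3 R]_(x in Omega) (k x ^+ 2)%:E <=
   \int[lebesgue3 R]_(x in Omega) rho x ^+ 4)%E.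
Proof.
move=> oI oL oOmega cPhi ck cm PhiO gK pos disint C0 len mrho rho0 adm_rho.
have oIL : open (I `*` Lambda) by exact: open_setX.
have mIL : measurable (I `*` Lambda : set mX) by exact: open_measurable3.
have mI : measurable (I : set mR) by exact: open_measurable.
(* [sigma] is the length density of a leaf and [tau] is [1 / h]. Since [h = k^2 / sigma], the
   functions [sigma] and [rho^4 tau] multiplied by [h] are [k^2] and [rho^4]. *)
pose kP z := k (Phi z); pose sigma z := Num.sqrt (kP z) * m z.
pose tau z := sigma z / kP z ^+ 2.
have ckP z : (I `*` Lambda) z -> {for z, continuous kP}.
  by move=> ILz; apply: continuous_comp; [exact: cPhi|exact/ck/PhiO].
have csigma z : (I `*` Lambda) z -> {for z, continuous sigma}.
  move=> ILz; apply: cvgM; last exact: cm.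
  by apply: (continuous_comp (ckP z ILz)); exact: sqrt_continuous.
have ctau z : (I `*` Lambda) z -> {for z, continuous tau}.
  move=> ILz; have [k0 _ _] := pos z ILz; apply: cvgM; first exact: csigma.
  apply: cvgV; first by rewrite expf_neq0// gt_eqF.
  by rewrite expr2; apply: cvgM; exact: ckP.
have mPhi := continuous_measurable_mapH oIL cPhi.
have msigma := continuous_measurable3 oIL csigma.
have mtau := continuous_measurable3 oIL ctau.
have mmm := continuous_measurable3 oIL cm.
have sigma0 z : (I `*` Lambda) z -> 0 < sigma z.
  by move=> ILz; have [k0 m0 _] := pos z ILz; rewrite mulr_gt0// sqrtr_gt0.
have tau0 z : (I `*` Lambda) z -> 0 < tau z.
  by move=> ILz; have [k0 m0 _] := pos z ILz; rewrite divr_gt0 ?sigma0// exprn_gt0.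
have mrP : measurable_fun (I `*` Lambda : set mX) (fun z : mX => rho (Phi z)).
  apply: (measurable_comp (F := (Omega : set mH))) mPhi => //; first exact: open_measurableH.
  by move=> _ [z /PhiO Oz <-].
have mpow4 d (T : measurableType d) (D : set T) (f : T -> \bar R) :
    measurable_fun D f -> measurable_fun D (fun x => f x ^+ 4)%E.
  move=> mf; have m2 : measurable_fun D (fun t => f t * f t)%E by exact: emeasurable_funM.
  apply: (eq_measurable_fun (fun t => (f t * f t) * (f t * f t))%E).
    by move=> t _; rewrite !expeS expe0 mule1 !muleA.
  exact: emeasurable_funM.
pose F1 : mX -> \bar R := (fun z => (sigma z)%:E) \_ (I `*` Lambda).
pose F2 : mX -> \bar R := (fun z => rho (Phi z) ^+ 4 * (tau z)%:E)%E \_ (I `*` Lambda).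
have mF1 : measurable_fun setT F1.
  by apply/(measurable_restrictT _ mIL); exact/measurable_EFinP.
have mF2 : measurable_fun setT F2.
  apply/(measurable_restrictT _ mIL); apply: emeasurable_funM; first exact: mpow4.
  exact/measurable_EFinP.
have F1_ge0 z : (0 <= F1 z)%E.
  by rewrite /F1 patchE; case: ifPn => // /set_mem ILz; rewrite lee_fin ltW// sigma0.
have F2_ge0 z : (0 <= F2 z)%E.
  rewrite /F2 patchE; case: ifPn => // /set_mem ILz.
  by rewrite mule_ge0 ?lee_fin ?(ltW (tau0 _ _))// expe_ge0// rho0//; exact: PhiO.
have F1_out z : ~ (I `*` Lambda) z -> F1 z = 0%E.
  by move=> nz; rewrite /F1 patchE memNset.
have F2_out z : ~ (I `*` Lambda) z -> F2 z = 0%E.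
  by move=> nz; rewrite /F2 patchE memNset.
have -> : (\int[lebesgue3 R]_(x in Omega) (k x ^+ 2)%:E =
    \int[nu]_p \int[mu]_t F1 (t, p))%E.
  rewrite -disint//; apply: eq_integral => x /set_mem Ox.
  have [ILg gx] := gK x Ox; have := pos _ ILg; rewrite gx => -[k0 m0 hE].
  rewrite /F1 patchE mem_set// hE -EFinM /sigma /kP gx; congr (_%:E).
  by rewrite mulrC divfK// mulf_neq0 ?gt_eqF ?sqrtr_gt0.
have -> : (\int[lebesgue3 R]_(x in Omega) rho x ^+ 4 =
    \int[nu]_p \int[mu]_t F2 (t, p))%E.
  rewrite -disint//; apply: eq_integral => x /set_mem Ox.
  have [ILg gx] := gK x Ox; have := pos _ ILg; rewrite gx => -[k0 m0 hE].
  rewrite /F2 patchE mem_set// hE -muleA -EFinM /tau /sigma /kP gx.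
  rewrite mulrA divfK ?expf_neq0 ?gt_eqF// divff ?mule1//.
  by rewrite mulf_neq0 ?gt_eqF ?sqrtr_gt0.
have mG1 : measurable_fun setT (fun p : mR2 => \int[mu]_t F1 (t, p))%E.
  exact: (@measurable_fun_fubini_tonelli_G _ _ mR mR2 R mu F1).
have mG2 : measurable_fun setT (fun p : mR2 => \int[mu]_t F2 (t, p))%E.
  exact: (@measurable_fun_fubini_tonelli_G _ _ mR mR2 R mu F2).
have C4 : 0 <= C ^- 4 by rewrite invr_ge0 exprn_ge0// ltW.
rewrite -ge0_integralZl//; last by move=> p _; exact: integral_ge0.
apply: ge0_le_integral => //.
- by move=> p _; rewrite mule_ge0//; exact: integral_ge0.
- exact: emeasurable_funM.
move=> p _; have [Lp|nLp] := pselect (Lambda p); last first.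
  rewrite (eq_integral (cst 0%E)) => [|t _]; last by rewrite F1_out// => -[].
  by rewrite integral0 mule0; exact: integral_ge0.
have slice d (T : measurableType d) (f : X -> T) :
    measurable_fun (I `*` Lambda : set mX) (f : mX -> T) ->
    measurable_fun (I : set mR) (fun t : mR => f (t, p)).
  move=> mf; apply: (measurable_comp (F := I `*` Lambda : set mX) (f := f)
    (g := fun t : mR => (t, p) : mX)) => //.
    by move=> _ [t It <-].
  exact: (measurable_funTS (measurable_pair2 p)).
have restr (f : X -> \bar R) : (\int[mu]_t (f \_ (I `*` Lambda)) (t, p) =
    \int[mu]_(t in I) f (t, p))%E.
  rewrite [RHS]integral_mkcond; apply: eq_integral => t _; rewrite !patchE.
  congr (if _ then _ else _); apply/idP/idP => /set_mem; last by move=> It; exact: mem_set.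
  by move=> -[It _]; exact: mem_set.
rewrite !restr len// -EFinM (_ : C ^- 4 * C = C ^- 3); last by field; rewrite gt_eqF.
apply: (leaf_inequality (k := fun t => kP (t, p)) (m := fun t => m (t, p))) => //.
- exact: slice.
- exact: (slice _ _ (fun z => rho (Phi z))).
- exact: (slice _ _ sigma).
- exact: (slice _ _ tau).
- by move=> t It; have ILtp : (I `*` Lambda) (t, p) by []; have [k0 m0 _] := pos _ ILtp;
    split => //; exact/rho0/PhiO.
- exact: len.
- exact: adm_rho.
Qed.

End modulus.

Theorem corollary2p2p4 (R : realType) (Omega : set (R * R * R))
    (Gamma : set (curve R)) (q : R * R * R -> R[i]) (C : R)
    (hOmega : domain Omega)
    (hGamma : foliated_by Omega Gamma)
    (hq : quadratic_differential Omega q)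
    (hB2 : forall p, Omega p -> B2 q p = 0)
    (hC : 0 < C)
    (htraj : forall c, Gamma c ->
       horizontal_trajectory Omega q c /\ q_length q c = C%:E) :
  M4 Omega Gamma = ((C ^- 4)%:E * q_volume Omega q)%E.
Proof.
have [oOmega _ [x0 Ox0]] := hOmega.
have [I [Lambda [Phi [[oI itvI] oL [CPhi [g [Cg PhiK gK]]] leg GammaE]]]] := hGamma.
pose leaf p := Curve I (fun s => Phi (s, p)).
have leafG p : Lambda p -> Gamma (leaf p) by move=> Lp; rewrite GammaE; exists p.
have hor p s : Lambda p -> I s -> 0 < q (Phi (s, p)) * curve_dz (leaf p) s ^+ 2.
  by move=> Lp Is; have [[_ _ +] _] := htraj _ (leafG p Lp); exact.
have len p : Lambda p -> q_length q (leaf p) = C%:E.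
  by move=> Lp; have [] := htraj _ (leafG p Lp).
have oIL : open (I `*` Lambda) by exact: open_setX.
have cq x : Omega x -> {for x, continuous (fun y => ComplexField.Normc.normc (q y))}.
  move=> Ox; have [cu cv] := hq 0%N.
  exact: continuous_normc (cu _ Ox) (cv _ Ox).
have CPhi_cont z : (I `*` Lambda) z -> {for z, continuous Phi}.
  by move=> ILz; exact: C1at_continuous (C1at_Ck2 oIL CPhi ILz).
have g_cont x : Omega x -> {for x, continuous g}.
  by move=> Ox; exact: C1at_continuous (C1at_Ck2 oOmega Cg Ox).
pose h := flow_density Phi g q.
have h_cont x : Omega x -> {for x, continuous h}.
  move=> Ox; apply: C1at_continuous.
  exact: (C1at_flow_density oOmega oI oL CPhi Cg gK hor hq Ox).
pose m z := ComplexField.Normc.normc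
  (Complex (leaf_velocity Phi z).1.1 (leaf_velocity Phi z).1.2).
have mE t p : I t -> Lambda p -> m (t, p) = ComplexField.Normc.normc (curve_dz (leaf p) t).
  by move=> It Lp; rewrite (curve_dzE oI oL CPhi It Lp).
have cm z : (I `*` Lambda) z -> {for z, continuous m}.
  move=> ILz; have cv := continuous_leaf_velocity oI oL CPhi ILz.
  have c1 : {for z, continuous (fun z => (leaf_velocity Phi z).1)}.
    by apply: (continuous_comp cv); exact: cvg_fst.
  by apply: continuous_normc => /=; apply: (continuous_comp c1); [exact: cvg_fst|exact: cvg_snd].
have h_ge0 x : Omega x -> 0 <= h x.
  by move=> Ox; apply/ltW; exact: (flow_density_gt0 oI oL CPhi gK hor).
have I0 : I !=set0 by exists (g x0).1; have [[]] := gK _ Ox0.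
have flow := integral_flow_eq0 oOmega oI oL CPhi Cg PhiK gK leg hor hq hB2.
have [nu disint] := disintegration oOmega oI oL itvI I0 CPhi_cont g_cont h_cont h_ge0
  PhiK gK flow.
have mI : measurable (I : set (measurableTypeR R)) by exact: open_measurable.
have pos z : (I `*` Lambda) z -> [/\ 0 < ComplexField.Normc.normc (q (Phi z)), 0 < m z &
    h (Phi z) = ComplexField.Normc.normc (q (Phi z)) ^+ 2 /
      (Num.sqrt (ComplexField.Normc.normc (q (Phi z))) * m z)].
  case: z => t p [It Lp]; rewrite (mE _ _ It Lp).
  exact: (flow_densityE oI oL CPhi PhiK gK hor It Lp).
have len' p : Lambda p -> (\int[lebesgue_measure]_(t in I)
    (Num.sqrt (ComplexField.Normc.normc (q (Phi (t, p)))) * m (t, p))%:E = C%:E)%E.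
  move=> Lp; rewrite -(len p Lp); apply: eq_integral => t /set_mem It.
  by rewrite (mE _ _ It Lp).
have C4 : 0 <= C ^- 4 by rewrite invr_ge0 exprn_ge0// ltW.
have eq_le (a b : \bar R) : a = b -> (a <= b)%E by move=> ->.
apply/le_anti/andP; split; last first.
  apply: le_ereal_inf_tmp => _ [rho [mrho rho0 rho_adm] <-].
  apply: (volume_le_integral_fourth oI oL oOmega CPhi_cont cq cm _ gK pos disint hC len' mrho rho0).
    by move=> z /PhiK[].
  move=> p Lp; apply: le_trans (rho_adm _ (leafG p Lp)) _.
  by apply/eq_le/eq_integral => t /set_mem It; rewrite (mE _ _ It Lp).
(* The equality case of the tangent inequality. Its integral over a leaf is the [q]-length divided
   by [C], that is 1, and its fourth power is [|q|^2 / C^4]. *)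
pose rho x := (Num.sqrt (ComplexField.Normc.normc (q x)) / C)%:E.
have crho x : Omega x ->
    {for x, continuous (fun y => Num.sqrt (ComplexField.Normc.normc (q y)) / C)}.
  move=> Ox; apply: cvgM; last exact: cvg_cst.
  by apply: (continuous_comp (cq x Ox)); exact: sqrt_continuous.
apply: ge_ereal_inf; exists (\int[lebesgue3 R]_(x in Omega) (rho x ^+ 4))%E.
  exists rho => //; split.
  - by apply/measurable_EFinP; exact: continuous_measurableH.
  - by move=> x _; rewrite lee_fin divr_ge0 ?sqrtr_ge0// ltW.
  - move=> c; rewrite GammaE => -[p Lp <-] /=.
    have -> : (1 = C^-1%:E * q_length q (leaf p))%E.
      by rewrite len// -EFinM mulVf// gt_eqF.
    rewrite -ge0_integralZl//; first last.
    - by rewrite lee_fin invr_ge0 ltW.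
    - by move=> t It; rewrite lee_fin mulr_ge0 ?sqrtr_ge0// /leaf cmodE sqrtr_ge0.
    - apply/measurable_EFinP; apply: (eq_measurable_fun
        (fun t => Num.sqrt (ComplexField.Normc.normc (q (Phi (t, p)))) * m (t, p))).
        by move=> t /set_mem It; rewrite (mE _ _ It Lp).
      apply: open_continuous_measurable_fun => // t /set_mem It.
      have ILtp : (I `*` Lambda) (t, p) by [].
      have [Ox _] := PhiK _ ILtp.
      have ctp : {for t, continuous (fun t => (t, p))} by exact: (cvg_pair cvg_id (cvg_cst _)).
      apply: cvgM; last exact: (continuous_comp ctp (cm _ ILtp)).
      have cPt := continuous_comp ctp (CPhi_cont _ ILtp).
      by apply: (continuous_comp (continuous_comp cPt (cq _ Ox))); exact: sqrt_continuous.
    apply/eq_le/eq_integral => t _; rewrite -!EFinM; congr (_%:E).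
    by rewrite mulrA [C^-1 * _]mulrC.
have mk : measurable_fun (Omega : set (measurableTypeR R * measurableTypeR R * measurableTypeR R))
    (fun x => (ComplexField.Normc.normc (q x) ^+ 2)%:E).
  apply/measurable_EFinP; apply: continuous_measurableH => // x Ox.
  exact: (continuous_comp (cq x Ox) (@exprn_continuous R 2 _)).
have -> : q_volume Omega q =
    (\int[lebesgue3 R]_(x in (Omega :
        set (measurableTypeR R * measurableTypeR R * measurableTypeR R)))
      (ComplexField.Normc.normc (q x) ^+ 2)%:E)%E by [].
rewrite -ge0_integralZl//; first last.
- by move=> x _; rewrite lee_fin sqr_ge0.
- exact: open_measurableH.
apply/eq_le/eq_integral => x _; rewrite -EFin_expe -EFinM; congr (_%:E).
rewrite expr_div_n mulrC; congr (_ * _).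
by rewrite -[4%N]/(2 * 2)%N exprM sqr_sqrtr// cmodE sqrtr_ge0.
Qed.
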